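(* Let $X=\ell_p$ (over $\mathbb{R}$ or $\mathbb{C}$) with $1<p\neq 2<\infty$, and let $\mathcal{B}_1(X)$ be the set of all bounded linear operators $T:X\to X$ with $\|T\|\le 1$. (1) If $p>2$, then the topologies $\mathtt{SOT}$ and $\mathtt{SOT}^*$ on $\mathcal{B}_1(X)$ are similar, and the topologies $\mathtt{WOT}$ and $\mathtt{SOT}_*$ on $\mathcal{B}_1(X)$ are similar. (2) If $1<p<2$, then the topologies $\mathtt{SOT}_*$ and $\mathtt{SOT}^*$ on $\mathcal{B}_1(X)$ are similar, and the topologies $\mathtt{WOT}$ and $\mathtt{SOT}$ on $\mathcal{B}_1(X)$ are similar.
   Context: Two topologies on a set are called similar if they have the same dense sets (equivalently, the same sets with empty interior). Operator topologies, for a net $(T_i)$ and $T$ in $\mathcal{B}(X)$ (bounded operators on $X$): $T_i\to T$ in $\mathtt{SOT}$ iff $T_ix\to Tx$ in norm for all $x\in X$; in $\mathtt{WOT}$ iff $T_ix\to Tx$ weakly for all $x\in X$; in $\mathtt{SOT}_*$ iff $T_i^*x^*\to T^*x^*$ in norm for all $x^*\in X^*$; in $\mathtt{SOT}^*$ iff $T_i\to T$ in both $\mathtt{SOT}$ and $\mathtt{SOT}_*$. On $\mathcal{B}_1(X)$ one considers the induced topologies. *)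

(* Defs.v *)
From HB Require Import structures.
From mathcomp Require Import all_boot all_order all_algebra.
From mathcomp Require Import all_classical all_reals all_analysis.
From mathcomp Require Import complex.

Set Implicit Arguments.
Unset Strict Implicit.
Unset Printing Implicit Defensive.

Import Order.TTheory GRing.Theory Num.Theory.
Import numFieldNormedType.Exports.

Local Open Scope classical_set_scope.
Local Open Scope ring_scope.

(* In a normed module over a numFieldType K the norm takes its values in K.
   [Kreal : R -> K] is the inclusion of the reals, and [Kre], the real part,
   recovers the real value of a norm; see [rnormE]. *)
Variant scalar_kind := RealScalars | ComplexScalars.

Section scalars.
Variable R : realType.
Implicit Type k : scalar_kind.

Definition scalar_field k : numFieldType :=
  match k with RealScalars => R | ComplexScalars => R[i] end.

Definition Kre k : scalar_field k -> R :=
  match k return scalar_field k -> R with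
  | RealScalars => id
  | ComplexScalars => @complex.Re R
  end.

Definition Kreal k : R -> scalar_field k :=
  match k return R -> scalar_field k with
  | RealScalars => id
  | ComplexScalars => fun r => Complex r 0
  end.

Lemma KrealK k : cancel (@Kreal k) (@Kre k).
Proof. by case: k. Qed.

Lemma ler_Kreal k (x y : R) : (Kreal k x <= Kreal k y) = (x <= y).
Proof. by case: k => //; exact: lecR. Qed.

Lemma KrealD k (x y : R) : Kreal k (x + y) = Kreal k x + Kreal k y.
Proof. by case: k => //; exact: (rmorphD (real_complex R)). Qed.

Lemma KrealM k (x y : R) : Kreal k (x * y) = Kreal k x * Kreal k y.
Proof. by case: k => //; exact: (rmorphM (real_complex R)). Qed.

Lemma Kreal0 k : Kreal k 0 = 0.
Proof. by case: k. Qed.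

Lemma Kreal1 k : Kreal k 1 = 1.
Proof. by case: k. Qed.

Lemma KreK k (a : scalar_field k) : 0 <= a -> Kreal k (Kre a) = a.
Proof.
case: k a => //= -[x y].
by rewrite lecE /= => /andP[/eqP -> _].
Qed.

Variable k : scalar_kind.

Definition rnorm (V : normedModType (scalar_field k)) (v : V) : R := Kre `|v|.

Lemma rnormE (V : normedModType (scalar_field k)) (v : V) : `|v| = Kreal k (rnorm v).
Proof. by rewrite KreK. Qed.

Section rnorm_theory.
Variable V : normedModType (scalar_field k).
Implicit Types v w : V.

Lemma rnorm_ge0 v : 0 <= rnorm v.
Proof. by rewrite -(ler_Kreal k) Kreal0 -rnormE. Qed.

Lemma ler_rnormD v w : rnorm (v + w) <= rnorm v + rnorm w.
Proof. by rewrite -(ler_Kreal k) KrealD -!rnormE ler_normD. Qed.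

Lemma rnormZ (a : scalar_field k) v :
  rnorm (a *: v) = rnorm (a : (scalar_field k)^o) * rnorm v.
Proof. by apply: (can_inj (@KrealK k)); rewrite KrealM -!rnormE normrZ. Qed.

Lemma rnorm0 : rnorm (0 : V) = 0.
Proof. by apply: (can_inj (@KrealK k)); rewrite Kreal0 -rnormE normr0. Qed.

Lemma rnorm0_eq0 v : rnorm v = 0 -> v = 0.
Proof. by move=> v0; apply: normr0_eq0; rewrite rnormE v0 Kreal0. Qed.

Lemma rnorm_Kreal (r : R) : 0 <= r -> rnorm (Kreal k r : (scalar_field k)^o) = r.
Proof.
move=> r0; apply: (can_inj (@KrealK k)); rewrite -rnormE ger0_norm//.
by rewrite -(Kreal0 k) ler_Kreal.
Qed.

End rnorm_theory.
End scalars.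

Arguments Kre {R k}.
Arguments Kreal {R} k.

Section lp_norm.
Variables (R : realType) (k : scalar_kind) (p : R).
Local Notation K := (scalar_field R k).
Local Notation abs := (fun a : K => rnorm (a : K^o)).

(* [Lnorm] for the counting measure is the usual l_p norm, with value +oo
   outside of l_p; see [lpnormE]. *)
Definition lpnorm (x : nat -> K) : \bar R :=
  Lnorm counting p%:E (fun n => (abs (x n))%:E).

Lemma lpnormE (x : nat -> K) : 0 < p ->
  lpnorm x = ((\sum_(n <oo) ((abs (x n)) `^ p)%:E) `^ p^-1)%E.
Proof.
move=> p0; rewrite /lpnorm Lnorm_counting//.
congr (_ `^ _)%E; apply: eq_eseriesr => n _.
by rewrite /= ger0_norm ?rnorm_ge0.
Qed.

Lemma lpnorm_ge0 x : (0 <= lpnorm x)%E.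
Proof. exact: Lnorm_ge0. Qed.

Variable p1 : 1 <= p.
Let p0 : 0 < p. Proof. exact: lt_le_trans ltr01 p1. Qed.

Lemma lpnormD x y : (lpnorm (x + y)%R <= lpnorm x + lpnorm y)%E.
Proof.
pose f n := abs (x n); pose g n := abs (y n).
have mf (h : nat -> R) : measurable_fun [set: nat] h by [].
apply: (@le_trans _ _ (Lnorm counting p%:E (EFin \o (f \+ g)%R))); last first.
  exact: (@minkowski_EFin _ _ R counting f g p (mf f) (mf g) p1).
rewrite lpnormE// Lnorm_counting//.
have sum_ge0 (h : nat -> R) : (forall n, 0 <= h n) ->
    ((\sum_(n <oo) (h n)%:E)%E \in `[0%E, +oo%E]).
  move=> h0; rewrite in_itv /= leey andbT.
  by apply: nneseries_ge0 => n _ _; rewrite lee_fin.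
apply: gt0_ler_poweR.
- by rewrite invr_ge0 ltW.
- by apply: sum_ge0 => n; exact: powR_ge0.
- by apply: (sum_ge0 (fun n => `|(f \+ g) n| `^ p)) => n; exact: powR_ge0.
apply: lee_nneseries => [n _|n _]; first by rewrite lee_fin powR_ge0.
rewrite /= lee_fin ge0_ler_powR ?nnegrE ?(ltW p0) ?rnorm_ge0//.
by rewrite (le_trans _ (ler_norm _))//; exact: (@ler_rnormD R k K^o).
Qed.

Lemma lpnormZ (a : K) x : (lpnorm (a *: x)%R = (abs a)%:E * lpnorm x)%E.
Proof.
rewrite !lpnormE//.
have -> : (\sum_(n <oo) ((abs ((a *: x) n)) `^ p)%:E =
           ((abs a) `^ p)%:E * \sum_(n <oo) ((abs (x n)) `^ p)%:E)%E.
  rewrite -nneseriesZl => [|n _]; last by rewrite lee_fin powR_ge0.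
  apply: eq_eseriesr => n _; rewrite -EFinM -powRM ?rnorm_ge0//.
  by congr (_ `^ _)%:E; exact: (@rnormZ R k K^o).
rewrite poweRM ?lee_fin ?powR_ge0//; last first.
  by apply: nneseries_ge0 => n _ _; rewrite lee_fin powR_ge0.
by rewrite poweR_EFin -powRrM mulfV ?gt_eqF// powRr1// rnorm_ge0.
Qed.

Lemma lpnorm0 : lpnorm 0 = 0%E.
Proof. by have := lpnormZ 0 0; rewrite scale0r rnorm0 mul0e. Qed.

Lemma lpnorm_eq0 x : lpnorm x = 0%E -> x = 0.
Proof.
have ge0 m : (0 <= ((abs (x m)) `^ p)%:E)%E by rewrite lee_fin powR_ge0.
have sum0 : (0 <= \sum_(n <oo) ((abs (x n)) `^ p)%:E)%E.
  by apply: nneseries_ge0 => n _ _; exact: ge0.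
rewrite lpnormE// => /(poweR_eq0_eq0 sum0) s0; apply/funext => n.
have : (((abs (x n)) `^ p)%:E <= 0)%E.
  rewrite -[leRHS]s0 (le_trans _ (@nneseries_lim_ge _ _ xpredT 0 n.+1 _))//.
  by rewrite big_nat_recr//= leeDr// sume_ge0.
rewrite lee_fin => xn0; apply: (@rnorm0_eq0 R k K^o); apply/eqP.
have : abs (x n) `^ p == 0 by rewrite eq_le xn0 powR_ge0.
by rewrite powR_eq0 => /andP[].
Qed.

End lp_norm.

(* The argument [p1] is kept in the type [lp] so that the norm inequality is
   available to the canonical normed-module structure. *)
Definition lp_pred (R : realType) (k : scalar_kind) (p : R) (p1 : 1 <= p) :
    {pred nat -> scalar_field R k} :=
  mem [set x | (lpnorm p x < +oo)%E].
Arguments lp_pred {R} k {p} p1.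

Record lp (R : realType) (k : scalar_kind) (p : R) (p1 : 1 <= p) :=
  Lp { lp_val :> nat -> scalar_field R k ; _ : lp_val \in lp_pred k p1 }.
Arguments lp {R} k {p} p1.

Section lp_normed_module.
Variables (R : realType) (k : scalar_kind) (p : R) (p1 : 1 <= p).
Local Notation K := (scalar_field R k).
Local Notation lp := (lp k p1).

HB.instance Definition _ := [isSub of lp for @lp_val R k p p1].
HB.instance Definition _ := [Choice of lp by <:].

Lemma lp_submod_closed : submod_closed (lp_pred k p1).
Proof.
split; first by rewrite inE /= lpnorm0.
move=> a x y; rewrite !inE /= => xoo yoo.
rewrite (le_lt_trans (lpnormD p1 _ _))// lpnormZ// lte_add_pinfty//.
by rewrite lte_mul_pinfty ?lee_fin ?rnorm_ge0.
Qed.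

HB.instance Definition _ := GRing.isSubmodClosed.Build _ _ (lp_pred k p1)
  lp_submod_closed.
HB.instance Definition _ := [SubChoice_isSubLmodule of lp by <:].

Definition lp_rnorm (x : lp) : R := fine (lpnorm p x).

Lemma lp_rnormE (x : lp) : (lp_rnorm x)%:E = lpnorm p x.
Proof.
rewrite fineK// ge0_fin_numE ?lpnorm_ge0//.
by case: x => x /=; rewrite inE.
Qed.

Lemma lp_normD (x y : lp) :
  Kreal k (lp_rnorm (x + y)) <= Kreal k (lp_rnorm x) + Kreal k (lp_rnorm y).
Proof.
rewrite -KrealD ler_Kreal -lee_fin EFinD !lp_rnormE.
exact: (lpnormD p1).
Qed.

Lemma lp_normZ (a : K) (x : lp) :
  Kreal k (lp_rnorm (a *: x)) = `|a| * Kreal k (lp_rnorm x).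
Proof.
rewrite [`|a|](rnormE (a : K^o)) -KrealM; congr Kreal.
by apply: EFin_inj; rewrite EFinM (lp_rnormE x) (lp_rnormE (a *: x)) lpnormZ.
Qed.

Lemma lp_norm0_eq0 (x : lp) : Kreal k (lp_rnorm x) = 0 -> x = 0.
Proof.
rewrite -(Kreal0 R k) => /(can_inj (@KrealK R k)) x0.
by apply/val_inj/(lpnorm_eq0 p1); rewrite -lp_rnormE x0.
Qed.

HB.instance Definition _ :=
  Lmodule_isNormed.Build K lp lp_normD lp_normZ lp_norm0_eq0.

Lemma rnorm_lp (x : lp) : rnorm x = fine (lpnorm p x).
Proof. exact: KrealK. Qed.

End lp_normed_module.


Definition bop_pred (R : realType) (k : scalar_kind)
    (X Y : normedModType (scalar_field R k)) : {pred X -> Y} :=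
  mem [set T : X -> Y |
        linear T /\ exists M : R, forall x, rnorm (T x) <= M * rnorm x].
Arguments bop_pred {R k} X Y.

Record bop (R : realType) (k : scalar_kind)
    (X Y : normedModType (scalar_field R k)) :=
  Bop { bop_val :> X -> Y ; _ : bop_val \in bop_pred X Y }.
Arguments bop {R k} X Y.

Section bop_normed_module.
Variables (R : realType) (k : scalar_kind) (X Y : normedModType (scalar_field R k)).
Local Notation K := (scalar_field R k).
Local Notation bop := (bop X Y).

HB.instance Definition _ := [isSub of bop for @bop_val R k X Y].
HB.instance Definition _ := [Choice of bop by <:].

Lemma bop_submod_closed : submod_closed (bop_pred X Y).
Proof.
split.
  have E x : (0 : X -> Y) x = 0 by [].
  rewrite inE /=; split; first by move=> a x y; rewrite !E scaler0 addr0.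
  by exists 0 => x; rewrite E mul0r rnorm0.
move=> a S T; rewrite !inE /= => -[linS [M SM]] [linT [N TN]]; split.
  move=> b x y; rewrite !fctE linS linT.
  by rewrite !scalerDr !scalerA (mulrC a b) addrACA.
exists (rnorm (a : K^o) * M + N) => x; rewrite mulrDl.
by rewrite (le_trans (ler_rnormD _ _))// lerD// rnormZ -mulrA ler_wpM2l ?rnorm_ge0.
Qed.

HB.instance Definition _ := GRing.isSubmodClosed.Build _ _ (bop_pred X Y)
  bop_submod_closed.
HB.instance Definition _ := [SubChoice_isSubLmodule of bop by <:].

Lemma bop_linear (T : bop) : linear T.
Proof. by case: T => T /=; rewrite inE => -[]. Qed.

HB.instance Definition _ (T : bop) :=
  GRing.isLinear.Build K X Y *:%R (T : X -> Y) (bop_linear T).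

Definition opnorm (T : bop) : R :=
  sup [set rnorm (T x) | x in [set x : X | rnorm x <= 1]].

Lemma opnorm_has_sup (T : bop) :
  has_sup [set rnorm (T x) | x in [set x : X | rnorm x <= 1]].
Proof.
split; first by exists (rnorm (T 0)), 0 => //=; rewrite rnorm0.
case: T => T /= /[!inE] -[_ [M TM]]; exists `|M| => _ [x /= x1 <-].
rewrite (le_trans (TM x))// (le_trans (ler_norm _))// normrM.
by rewrite (ger0_norm (rnorm_ge0 x)) ler_piMr.
Qed.

Lemma opnorm_ub (T : bop) (x : X) : rnorm x <= 1 -> rnorm (T x) <= opnorm T.
Proof. by move=> x1; apply: ub_le_sup; [case: (opnorm_has_sup T)|exists x]. Qed.

Lemma opnorm_le (T : bop) (M : R) :
  (forall x, rnorm x <= 1 -> rnorm (T x) <= M) -> opnorm T <= M.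
Proof.
move=> TM; apply: ge_sup; first by case: (opnorm_has_sup T).
by move=> _ [x /= x1 <-]; exact: TM.
Qed.

Lemma opnorm_ge0 (T : bop) : 0 <= opnorm T.
Proof. by rewrite (le_trans _ (@opnorm_ub T 0 _)) ?rnorm_ge0 ?rnorm0. Qed.

Lemma rnorm_le_opnorm (T : bop) (x : X) : rnorm (T x) <= opnorm T * rnorm x.
Proof.
have [->|x0] := eqVneq x 0; first by rewrite linear0 !rnorm0 mulr0.
have nx0 : 0 < rnorm x.
  by rewrite lt_neqAle rnorm_ge0 andbT eq_sym; apply: contra_neq x0 => /rnorm0_eq0.
pose a := Kreal k (rnorm x)^-1.
have na : rnorm (a : K^o) = (rnorm x)^-1 by rewrite rnorm_Kreal ?invr_ge0 ?ltW.
rewrite -ler_pdivrMr// mulrC -na -rnormZ -linearZ.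
by apply: opnorm_ub; rewrite rnormZ na mulVf ?gt_eqF.
Qed.

Lemma bop_normD (S T : bop) :
  Kreal k (opnorm (S + T)) <= Kreal k (opnorm S) + Kreal k (opnorm T).
Proof.
rewrite -KrealD ler_Kreal; apply: opnorm_le => x x1.
by rewrite (le_trans (ler_rnormD _ _))// lerD// opnorm_ub.
Qed.

Lemma opnormZ (a : K) (T : bop) :
  opnorm (a *: T) = rnorm (a : K^o) * opnorm T.
Proof.
apply/eqP; rewrite eq_le; apply/andP; split.
  apply: opnorm_le => x x1.
  by rewrite [rnorm _](rnormZ a (T x)) ler_wpM2l ?rnorm_ge0 ?opnorm_ub.
have [->|a0] := eqVneq a 0; first by rewrite rnorm0 mul0r opnorm_ge0.
have na0 : 0 < rnorm (a : K^o).
  rewrite lt_neqAle rnorm_ge0 andbT eq_sym; apply: contra_neq a0.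
  exact: (@rnorm0_eq0 R k K^o).
rewrite -ler_pdivlMl//; apply: opnorm_le => x x1.
rewrite ler_pdivlMl// -rnormZ.
exact: (@opnorm_ub (a *: T) x x1).
Qed.

Lemma bop_normZ (a : K) (T : bop) :
  Kreal k (opnorm (a *: T)) = `|a| * Kreal k (opnorm T).
Proof. by rewrite opnormZ [`|a|](rnormE (a : K^o)) -KrealM. Qed.

Lemma bop_norm0_eq0 (T : bop) : Kreal k (opnorm T) = 0 -> T = 0.
Proof.
rewrite -(Kreal0 R k) => /(can_inj (@KrealK R k)) T0.
apply/val_inj/funext => x; apply: rnorm0_eq0; apply/eqP.
by rewrite eq_le rnorm_ge0 andbT (le_trans (rnorm_le_opnorm T x))// T0 mul0r.
Qed.

HB.instance Definition _ :=
  Lmodule_isNormed.Build K bop bop_normD bop_normZ bop_norm0_eq0.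

Lemma rnorm_bop (T : bop) : rnorm T = opnorm T.
Proof. exact: KrealK. Qed.

End bop_normed_module.

Definition dual_space (R : realType) (k : scalar_kind)
  (X : normedModType (scalar_field R k)) := bop X (scalar_field R k)^o.

Section adjoint.
Variables (R : realType) (k : scalar_kind) (X : normedModType (scalar_field R k)).

Lemma adjoint_subproof (T : bop X X) (f : dual_space X) :
  f \o T \in bop_pred X (scalar_field R k)^o.
Proof.
rewrite inE /=; split; first by move=> a x y /=; rewrite !linearP.
exists (opnorm f * opnorm T) => x /=.
rewrite (le_trans (rnorm_le_opnorm f _))// -mulrA ler_wpM2l ?opnorm_ge0//.
exact: rnorm_le_opnorm.
Qed.

Definition adjoint (T : bop X X) (f : dual_space X) : dual_space X :=
  Bop (adjoint_subproof T f).

End adjoint.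

Lemma cvg_initial_topology (S : choiceType) (T : topologicalType) (f : S -> T)
    (F : set_system S) (s : S) : Filter F ->
  F --> (s : initial_topology f) <-> f @ F --> f s.
Proof.
move=> FF; split=> [Fs A fA|fFs].
  by apply: Fs; exact: (@initial_continuous S T f s A fA).
move=> A; rewrite (@nbhsE (initial_topology f)) => -[_ [[C oC <-] Cs] CA].
by apply: filterS CA _; apply: fFs; exact: open_nbhs_nbhs.
Qed.

Section operator_topologies.
Variables (R : realType) (k : scalar_kind) (X : normedModType (scalar_field R k)).

Definition weak_top : Topological X :=
  Topological.class (sup_topology (fun f : dual_space X =>
    Topological.class (initial_topology (f : X -> (scalar_field R k)^o)))).

Lemma cvg_weak (F : set_system X) (x : X) : Filter F ->
  F --> (x : Topological.Pack weak_top) <->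
  forall f : dual_space X, (f y : (scalar_field R k)^o) @[y --> F] --> f x.
Proof.
move=> FF; split=> [/cvg_sup Fx f|Fx]; first exact/cvg_initial_topology/Fx.
by apply/cvg_sup => f; exact/cvg_initial_topology/Fx.
Qed.

Definition SOT : Topological (bop X X) :=
  Topological.class (sup_topology (fun x : X =>
    Topological.class (initial_topology (fun T : bop X X => T x)))).

Definition WOT : Topological (bop X X) :=
  Topological.class (sup_topology (fun x : X =>
    Topological.class
      (initial_topology (fun T : bop X X => T x : Topological.Pack weak_top)))).

(* The topology SOT_* *)
Definition SOT_sub_star : Topological (bop X X) :=
  Topological.class (sup_topology (fun f : dual_space X =>
    Topological.class (initial_topology (fun T : bop X X => adjoint T f)))).

(* The topology SOT^* *)
Definition SOT_sup_star : Topological (bop X X) :=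
  Topological.class (sup_topology (fun b : bool =>
    if b then SOT else SOT_sub_star)).

Section cvg_operator_topologies.
Variable (F : set_system (bop X X)).
Context {FF : Filter F}.
Variable T : bop X X.

Lemma cvg_SOT : F --> (T : Topological.Pack SOT) <->
  forall x : X, S x @[S --> F] --> T x.
Proof.
split=> [/cvg_sup FT x|FT].
  by have /cvg_initial_topology := FT x; exact.
apply/cvg_sup => x; apply/cvg_initial_topology.
exact: FT.
Qed.

Lemma cvg_WOT : F --> (T : Topological.Pack WOT) <->
  forall (x : X) (f : dual_space X), (f (S x) : (scalar_field R k)^o) @[S --> F] --> f (T x).
Proof.
split=> [/cvg_sup FT x f|FT].
  have /cvg_initial_topology/cvg_weak := FT x; exact.
apply/cvg_sup => x; apply/cvg_initial_topology/cvg_weak => f.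
exact: FT.
Qed.

Lemma cvg_SOT_sub_star : F --> (T : Topological.Pack SOT_sub_star) <->
  forall f : dual_space X, adjoint S f @[S --> F] --> adjoint T f.
Proof.
split=> [/cvg_sup FT f|FT].
  by have /cvg_initial_topology := FT f; exact.
apply/cvg_sup => f; apply/cvg_initial_topology.
exact: FT.
Qed.

Lemma cvg_SOT_sup_star : F --> (T : Topological.Pack SOT_sup_star) <->
  F --> (T : Topological.Pack SOT) /\ F --> (T : Topological.Pack SOT_sub_star).
Proof.
split=> [/cvg_sup FT|[F1 F2]]; first by split; [exact: (FT true)|exact: (FT false)].
by apply/cvg_sup => -[].
Qed.

End cvg_operator_topologies.

Definition bop_ball1 : set (bop X X) := [set T | `|T| <= 1].

End operator_topologies.

Arguments bop_ball1 {R k} X.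

Definition induced_topology (T : choiceType) (tau : Topological T) (A : set T) :
    Topological A :=
  Topological.class (initial_topology (set_val : A -> Topological.Pack tau)).

Definition similar_topologies (T : Type) (tau1 tau2 : Topological T) :=
  forall D : set T,
    @dense (Topological.Pack tau1) D <-> @dense (Topological.Pack tau2) D.

(* Main.v *)
Require Import Defs.
From mathcomp Require Import all_boot all_order all_algebra.
From mathcomp Require Import all_classical all_reals all_analysis.
From mathcomp Require Import complex ring lra.

(** Two comparable topologies are similar as soon as every neighbourhood of a
    point for the finer one contains a nonempty set that is open for the coarser
    one [similar_induced].  All the topologies considered here lie between WOT
    and SOT^*, and on the unit ball SOT is generated by the countably many maps
    S |-> S e_j, and SOT_* by the maps S |-> adjoint S e_j', where e_j' is the
    j-th coordinate functional (this uses p > 1).  So it suffices to prove that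
    these maps are tame: every SOT^*-open subset U of the ball contains some T
    such that S |-> S e_j (if p < 2), or S |-> adjoint S e_j' (if p > 2), has
    oscillation at most e on some WOT-neighbourhood of T in the ball
    [vector_dist_tame, functional_dist_tame].  Since WOT is coarser than SOT^*,
    finitely many coordinates can be treated one after the other
    [Delta_tame_finite].

    Such a T comes from vectors that T almost norms.  Let |x| <= 1 with |T x|
    almost 1, and let S be a contraction WOT-close to T; then finitely many
    coordinates of S x already carry almost all of the norm of T x.  If p < 2
    and x_j <> 0, replacing x by x + z e_j and x - z e_j increases |x|^p by
    O(z^2) on average, whereas the part of S e_j outside those finitely many
    coordinates adds z^p times its p-th power norm; as z^p is much larger than
    z^2, this part is small [row_rigidity].  If p > 2 and (S x)_j <> 0, replacing
    x by x + s u and x - s u, where u is supported off x, increases |x|^p by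
    at most s^p, whereas the j-th coordinate of S u adds a multiple of
    s^2 |(S u)_j|^2; now s^2 is much larger than s^p, so (S u)_j is small
    [column_rigidity].  Either way nothing escapes to infinity, and the finitely
    many remaining coordinates are controlled by WOT.

    It remains to find, SOT^*-near a given contraction T0, a contraction almost
    norming vectors x with x_j, respectively (T x)_j, bounded away from 0.  Let Q
    erase a far coordinate M and perturb (1 - eta) Q T0 Q by a matrix entry eta at
    the place (M, j) if p < 2, at the place (j, M) if p > 2, and an entry d at
    (M, M), with d as large as contractivity permits.  If the coordinate in
    question were small at all almost normed vectors, the entry eta could be
    raised at almost no cost in norm; a convex combination with the contractions
    having entries (0, 1) and (0, 0) then restores eta and leaves d larger by a
    fixed amount, which cannot be repeated for ever [extremal_perturbation].  As
    M goes to infinity and eta to 0, these operators tend to T0 in SOT^*,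
    whatever the values of d in [0, 1] [perturbed_cvg]. *)

Set Implicit Arguments.
Unset Strict Implicit.
Unset Printing Implicit Defensive.

Import Order.TTheory GRing.Theory Num.Theory.
Import numFieldNormedType.Exports.
Local Open Scope classical_set_scope.
Local Open Scope ring_scope.

(** * Real powers *)

Section powR_inequalities.
Variable R : realType.
Implicit Types (a b p q s t u v C : R) (n : nat).

Lemma powR_midpoint p u v : 1 <= p -> 0 <= u -> 0 <= v ->
  2 * ((u + v) / 2) `^ p <= u `^ p + v `^ p.
Proof.
move=> p1 u0 v0.
have h2 : (0 <= 2^-1 :> R) && (2^-1 <= 1 :> R) by apply/andP; split; lra.
have /andP[h20 h21] := h2.
have := @convex_powR _ _ p1 (Itv01 h20 h21) u v.
rewrite !inE /= !in_itv /= !andbT => /(_ u0 v0).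
rewrite !convRE /= => H. rewrite /unstable.onem in H.
have -> : (u + v) / 2 = 2^-1 * u + (1 - 2^-1) * v by field.
lra.
Qed.

Lemma ler_powRD1 q t : q <= 1 -> 0 <= t -> (1 + t) `^ q <= 1 + t.
Proof. by move=> q1 t0; apply: ler1_powR => //; rewrite lerDl. Qed.

Lemma ler_powR1D q t : 1 <= q -> 0 <= t -> 1 + t <= (1 + t) `^ q.
Proof. by move=> q1 t0; apply: le1r_powR => //; rewrite lerDl. Qed.

Lemma powR_sqr p a : 0 <= a -> (a ^+ 2) `^ (p / 2) = a `^ p.
Proof.
move=> a0; rewrite -powR_mulrn// -powRrM; congr (_ `^ _).
by rewrite mulrC divfK.
Qed.

Lemma powR_sqrD p a b : 0 < a ->
  (a ^+ 2 + b ^+ 2) `^ (p / 2) = a `^ p * (1 + (b / a) ^+ 2) `^ (p / 2).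
Proof.
move=> a0; rewrite -(powR_sqr p (ltW a0))// -powRM ?addr_ge0 ?sqr_ge0//.
by congr (_ `^ _); field; rewrite gt_eqF.
Qed.

Lemma powRB2 p a b : 0 < a ->
  a `^ p * (1 + (b / a) ^+ 2) = a `^ p + a `^ (p - 2) * b ^+ 2.
Proof.
move=> a0; rewrite powRB ?(gt_eqF a0) ?implybT// powR_mulrn ?ltW//.
by field; rewrite gt_eqF.
Qed.

Lemma powR_le_iff p a b : 0 < p -> 0 <= a -> 0 <= b ->
  (a `^ p <= b `^ p) = (a <= b).
Proof.
move=> p0 a0 b0; apply/idP/idP; last exact: ge0_ler_powR (ltW p0) _ _ _ _.
apply: contraTT; rewrite -!ltNge; exact: gt0_ltr_powR.
Qed.

Lemma bernoulli_powR p n s : 1 < p -> 0 <= s -> s <= 1 -> p <= n%:R ->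
  1 - n%:R * s <= (1 - s) `^ p.
Proof.
move=> p1 s0 s1 pn; have p0 : 0 < p by exact: lt_trans p1.
have bern m : 1 - m%:R * s <= (1 - s) ^+ m.
  elim: m => [|m IH]; first by rewrite mul0r subr0 expr0.
  rewrite exprS -natr1; have := ler0n R m.
  have : 0 <= 1 - s by lra.
  move: IH; nra.
have [->|s1'] := eqVneq s 1.
  rewrite subrr powR0 ?gt_eqF// mulr1 subr_le0; exact: le_trans (ltW p1) _.
have s10 : 0 < 1 - s <= 1 by rewrite subr_gt0 lt_neqAle s1' s1 gerBl.
apply: le_trans (bern n) _; rewrite -powR_mulrn; last by case/andP: s10 => /ltW.
exact: ger_powR.
Qed.

(** Up to replacing p by an integer n >= p, this is the mean value inequality
    for the p-th power; it follows from the Bernoulli inequality. *)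
Lemma powRD_sub p n u t : 1 < p -> 0 <= u -> 0 < t -> p <= n%:R ->
  (u + t) `^ p - u `^ p <= n%:R * t * (u + t) `^ (p - 1).
Proof.
move=> p1 u0 t0 pn; have p0 : 0 < p by exact: lt_trans p1.
have v0 : 0 < u + t by rewrite ltr_wpDl.
have s1 : t / (u + t) <= 1 by rewrite ler_pdivrMr// mul1r lerDr.
have := bernoulli_powR p1 (divr_ge0 (ltW t0) (ltW v0)) s1 pn.
rewrite -(ler_pM2r (powR_gt0 p v0)) -powRM ?subr_ge0 ?(ltW v0)//.
have -> : (1 - t / (u + t)) * (u + t) = u by field; rewrite gt_eqF.
have E : n%:R * (t / (u + t)) * (u + t) `^ p = n%:R * t * (u + t) `^ (p - 1).
  by rewrite -(mulr_powRB1 (ltW v0) p0); field; rewrite gt_eqF.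
by rewrite mulrBl mul1r E; lra.
Qed.

Lemma powR_unbounded s C : 0 < s -> exists n : nat, C < n%:R `^ s.
Proof.
move=> s0; exists (Num.truncn (`|C| `^ s^-1)).+1.
rewrite (le_lt_trans (ler_norm C))//.
have CE : (`|C| `^ s^-1) `^ s = `|C| by rewrite -powRrM mulVf ?gt_eqF// powRr1.
rewrite -[ltLHS]CE.
by apply: gt0_ltr_powR; rewrite ?nnegrE ?powR_ge0 ?ler0n ?truncnS_gt.
Qed.

End powR_inequalities.

(** * Power inequalities for real and complex scalars *)

Section scalar_inequalities.
Variables (R : realType) (k : scalar_kind).
Local Notation K := (scalar_field R k).
Local Notation abs := (fun a : K => rnorm (a : K^o)).
Implicit Types (a b : K) (p : R).

Lemma scalar_parallelogram a b :
  abs (a + b) ^+ 2 + abs (a - b) ^+ 2 = 2 * (abs a ^+ 2 + abs b ^+ 2).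
Proof.
rewrite /rnorm /Kre; case: k a b => /= [a b|[a1 a2] [b1 b2]].
  by rewrite !real_normK ?num_real//; ring.
by rewrite !sqr_sqrtr ?addr_ge0 ?sqr_ge0//; ring.
Qed.

Let abs_ge0 a : 0 <= abs a. Proof. exact: rnorm_ge0. Qed.
#[local] Hint Resolve abs_ge0 : core.

Lemma powR_scalarDB_ge p a b : 1 <= p ->
  2 * abs a `^ p <= abs (a + b) `^ p + abs (a - b) `^ p.
Proof.
move=> p1; apply: le_trans (powR_midpoint p1 _ _) => //.
rewrite ler_pM2l// ge0_ler_powR ?nnegrE ?(le_trans _ p1) ?divr_ge0 ?addr_ge0//.
have := @ler_rnormD R k K^o (a + b) (a - b).
rewrite [X in rnorm X](_ : _ = (Kreal k (2 : R) : K) *: (a : K^o)).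
  by rewrite rnormZ rnorm_Kreal// ler_pdivlMr// mulrC.
by rewrite addrACA subrr addr0 (KrealD k 1 1) Kreal1 scalerDl scale1r.
Qed.

Lemma abs_distC a b : abs (a - b) = abs (b - a).
Proof. by rewrite /rnorm distrC. Qed.

Lemma powR_scalarDB_ger p a b : 1 <= p ->
  2 * abs b `^ p <= abs (a + b) `^ p + abs (a - b) `^ p.
Proof. by move=> p1; rewrite addrC abs_distC addrC (addrC a); exact: powR_scalarDB_ge. Qed.

(** The parallelogram law and the convexity of t |-> t^(p/2) replace the
    absolute values of a + b and a - b by the square root of
    |a|^2 + |b|^2; the opposite inequality for p <= 2 is [powR_scalarDB_le2].
    This change of direction at p = 2 separates the cases p < 2 and p > 2. *)
Lemma powR_scalarDB_ge2 p a b : 2 <= p -> 0 < abs a ->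
  2 * (abs a `^ p + abs a `^ (p - 2) * abs b ^+ 2) <=
    abs (a + b) `^ p + abs (a - b) `^ p.
Proof.
move=> p2 a0; have p21 : 1 <= p / 2 by rewrite ler_pdivlMr ?mul1r.
rewrite -powRB2//.
have := powR_midpoint p21 (sqr_ge0 (abs (a + b))) (sqr_ge0 (abs (a - b))).
rewrite !powR_sqr// scalar_parallelogram mulrAC divff// mul1r powR_sqrD//.
apply: le_trans; rewrite ler_pM2l// ler_pM2l ?powR_gt0//.
by rewrite ler_powR1D ?sqr_ge0.
Qed.

Lemma powR_scalarDB_le2 p a b : 1 <= p -> p <= 2 -> 0 < abs a ->
  abs (a + b) `^ p + abs (a - b) `^ p <=
    2 * (abs a `^ p + abs a `^ (p - 2) * abs b ^+ 2).
Proof.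
move=> p1 p2 a0; have p0 : 0 < p by exact: lt_le_trans p1.
have p21 : 1 <= 2 / p by rewrite ler_pdivlMr ?mul1r.
have H := powR_midpoint p21 (powR_ge0 (abs (a + b)) p) (powR_ge0 (abs (a - b)) p).
rewrite -powRB2//.
apply: (@le_trans _ _ (2 * (abs a ^+ 2 + abs b ^+ 2) `^ (p / 2))); last first.
  rewrite powR_sqrD// ler_pM2l// ler_pM2l ?powR_gt0//.
  by rewrite ler_powRD1 ?sqr_ge0// ler_pdivrMr ?mul1r.
rewrite mulrC -ler_pdivrMr// -(@powR_le_iff _ (2 / p)) ?divr_ge0 ?addr_ge0
  ?powR_ge0//; last first.
  by rewrite divr_gt0.
have pE : p / 2 * (2 / p) = 1 by field; rewrite gt_eqF.
rewrite -powRrM pE powRr1 ?addr_ge0 ?sqr_ge0//.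
rewrite -(@ler_pM2l _ 2)// (le_trans H)// -!powRrM mulrCA divff ?(gt_eqF p0)// mulr1.
by rewrite !powR_mulrn// scalar_parallelogram.
Qed.

End scalar_inequalities.

(** * Bounded operators *)

Section bounded_operators.
Variables (R : realType) (k : scalar_kind).
Local Notation K := (scalar_field R k).

Lemma rnormN (V : normedModType K) (v : V) : rnorm (- v) = rnorm v.
Proof. by rewrite /rnorm normrN. Qed.

Lemma rnorm_distC (V : normedModType K) (v w : V) : rnorm (v - w) = rnorm (w - v).
Proof. by rewrite /rnorm distrC. Qed.

Lemma ler_rnormB (V : normedModType K) (v w : V) :
  rnorm (v - w) <= rnorm v + rnorm w.
Proof. by rewrite -(rnormN w) ler_rnormD. Qed.

Lemma rnormZ_Kreal (V : normedModType K) (r : R) (v : V) : 0 <= r ->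
  rnorm (Kreal k r *: v) = r * rnorm v.
Proof. by move=> r0; rewrite rnormZ rnorm_Kreal. Qed.

Variables X Y : normedModType K.

Lemma bopP (f : X -> Y) (M : R) : linear f ->
  (forall x, rnorm (f x) <= M * rnorm x) -> f \in bop_pred X Y.
Proof. by move=> lf fM; rewrite inE /=; split => //; exists M. Qed.

Lemma opnorm_le1P (T : bop X Y) :
  (forall x, rnorm (T x) <= rnorm x) -> opnorm T <= 1.
Proof. by move=> T1; apply: opnorm_le => x x1; rewrite (le_trans (T1 x)). Qed.

Lemma le_opnorm1 (T : bop X Y) x : opnorm T <= 1 -> rnorm (T x) <= rnorm x.
Proof.
by move=> T1; rewrite (le_trans (rnorm_le_opnorm T x))// ler_piMl ?rnorm_ge0.
Qed.

Lemma rank1_subproof (f : dual_space X) (v : Y) :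
  (fun x => (f x : K) *: v) \in bop_pred X Y.
Proof.
apply: (@bopP _ (opnorm f * rnorm v)) => [a x y|x].
  by rewrite linearP scalerDl scalerA.
by rewrite rnormZ mulrAC ler_wpM2r ?rnorm_ge0// rnorm_le_opnorm.
Qed.

(** The operator usually written f (x) v, where (x) is the tensor product. *)
Definition rank1 (f : dual_space X) (v : Y) : bop X Y := Bop (rank1_subproof f v).

Lemma bopDE (S T : bop X Y) x : (S + T) x = S x + T x. Proof. by []. Qed.
Lemma bopZE a (T : bop X Y) x : (a *: T) x = a *: T x. Proof. by []. Qed.

Lemma bop_add (T : bop X Y) x y : T (x + y) = T x + T y.
Proof. exact: linearD. Qed.
Lemma bop_sub (T : bop X Y) x y : T (x - y) = T x - T y.
Proof. exact: linearB. Qed.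
Lemma bop_scale (T : bop X Y) a x : T (a *: x) = a *: T x.
Proof. exact: linearZ. Qed.

Lemma bop_comp_subproof (S : bop Y Y) (T : bop X Y) : S \o T \in bop_pred X Y.
Proof.
apply: (@bopP _ (opnorm S * opnorm T)) => [a x y /=|x /=].
  by rewrite !linearP.
rewrite (le_trans (rnorm_le_opnorm S _))// -mulrA ler_wpM2l ?opnorm_ge0//.
exact: rnorm_le_opnorm.
Qed.

End bounded_operators.

(** * Coordinates, truncations and functionals of l_p *)

Section lp_coordinates.
Variables (R : realType) (k : scalar_kind) (p : R) (p1 : 1 < p).
Local Notation K := (scalar_field R k).
Local Notation abs := (fun a : K => rnorm (a : K^o)).
Local Notation X := (lp k (ltW p1)).
Implicit Types (x y : X) (m n i j : nat).

Let p0 : 0 < p. Proof. exact: lt_trans ltr01 p1. Qed.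

(** The p-th power of the norm is handled through its partial sums only, by
    [power_sum_le] and [rnorm_pow_le]. *)
Definition power_sum m (x : nat -> K) : R := \sum_(n < m) abs (x n) `^ p.

Lemma power_sumS m (x : nat -> K) : power_sum m.+1 x = power_sum m x + abs (x m) `^ p.
Proof. by rewrite /power_sum big_ord_recr. Qed.

Lemma power_sum_homo (x : nat -> K) : {homo (power_sum^~ x) : m n / (m <= n)%N >-> m <= n}.
Proof. by apply: homo_leq (@le_trans _ _) _ => // m; rewrite power_sumS lerDl powR_ge0. Qed.

Lemma power_sum_ge0 m (x : nat -> K) : 0 <= power_sum m x.
Proof. by apply: sumr_ge0 => n _; exact: powR_ge0. Qed.

Lemma nneseries_power_sum_le (x : nat -> K) C : (forall m, power_sum m x <= C) ->
  (\sum_(n <oo) (abs (x n) `^ p)%:E <= C%:E)%E.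
Proof.
move=> xC; apply: lime_le.
  by apply: is_cvg_nneseries => n _ _; rewrite lee_fin powR_ge0.
by apply: nearW => m; rewrite big_mkord sumEFin lee_fin; exact: xC.
Qed.

Lemma rnorm_powE x : ((rnorm x `^ p)%:E = \sum_(n <oo) (abs (x n) `^ p)%:E)%E.
Proof.
rewrite rnorm_lp -poweR_EFin -/(lp_rnorm x) lp_rnormE lpnormE// -poweRrM.
by rewrite mulVf ?gt_eqF// poweRe1// nneseries_ge0// => n _ _; rewrite lee_fin powR_ge0.
Qed.

Lemma power_sum_le m x : power_sum m x <= rnorm x `^ p.
Proof.
rewrite -lee_fin rnorm_powE.
rewrite (le_trans _ (@nneseries_lim_ge _ _ xpredT 0 m _))//.
  by rewrite big_mkord sumEFin.
by move=> n _ _; rewrite lee_fin powR_ge0.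
Qed.

Lemma rnorm_pow_le x C : (forall m, power_sum m x <= C) -> rnorm x `^ p <= C.
Proof. by move=> xC; rewrite -lee_fin rnorm_powE; exact: nneseries_power_sum_le. Qed.

Lemma power_sum_gt x e : 0 < e -> exists m, rnorm x `^ p - e < power_sum m x.
Proof.
move=> e0; apply: contrapT => /forallNP H.
suff : rnorm x `^ p <= rnorm x `^ p - e by rewrite lerBrDr gerDl leNgt e0.
by apply: rnorm_pow_le => m; rewrite leNgt; exact/negP/H.
Qed.

Lemma rnorm_le_pow (x y : X) : (rnorm x <= rnorm y) = (rnorm x `^ p <= rnorm y `^ p).
Proof. by rewrite powR_le_iff ?rnorm_ge0. Qed.

Lemma rnorm_le1_pow x : (rnorm x <= 1) = (rnorm x `^ p <= 1).
Proof.
have E : (1 : R) `^ p = 1 by rewrite powR1.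
by rewrite -[X in _ = (_ <= X)]E powR_le_iff ?rnorm_ge0.
Qed.

Lemma coord_le x n : abs (x n) <= rnorm x.
Proof.
rewrite -(powR_le_iff p0) ?rnorm_ge0// (le_trans _ (power_sum_le n.+1 x))//.
by rewrite power_sumS lerDr power_sum_ge0.
Qed.

Lemma power_sum_unitv i m : power_sum m (fun n => (n == i)%:R : K) <= 1.
Proof.
suff -> : power_sum m (fun n => (n == i)%:R : K) = (i < m)%:R by rewrite lern1 leq_b1.
elim: m => [|m IH]; first by rewrite /power_sum big_ord0.
rewrite power_sumS IH [in RHS]ltnS [in RHS]leq_eqVlt (eq_sym i).
have [->|mi] /= := eqVneq m i.
  by rewrite ltnn add0r -(Kreal1 R k) rnorm_Kreal// powR1.
by rewrite rnorm0 powR0 ?addr0// gt_eqF.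
Qed.

Lemma unitv_subproof i : (fun n => (n == i)%:R : K) \in lp_pred k (ltW p1).
Proof.
rewrite inE /= lpnormE// poweR_lty//.
rewrite (@le_lt_trans _ _ 1%:E) ?ltey//.
exact/nneseries_power_sum_le/power_sum_unitv.
Qed.

Definition unitv i : X := Lp (unitv_subproof i).

Lemma lpDE x y n : (x + y) n = x n + y n. Proof. by []. Qed.
Lemma lpBE x y n : (x - y) n = x n - y n. Proof. by []. Qed.
Lemma lpZE a x n : (a *: x) n = a * x n. Proof. by []. Qed.
Lemma lp_ext x y : (forall n, x n = y n) -> x = y.
Proof. by move=> xy; apply/val_inj/funext. Qed.
Lemma unitvE i n : unitv i n = (n == i)%:R. Proof. by []. Qed.

Lemma coordf_subproof n : (fun x : X => x n : K^o) \in bop_pred X K^o.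
Proof.
apply: (@bopP _ _ _ _ _ 1) => [a x y //|x].
by rewrite mul1r coord_le.
Qed.

Definition coordf n : dual_space X := Bop (coordf_subproof n).

Lemma coordfE n x : coordf n x = x n. Proof. by []. Qed.

Lemma addunitv_eq x (a : K) j : x j = 0 -> (x + a *: unitv j) j = a.
Proof. by move=> xj; rewrite lpDE lpZE unitvE xj eqxx mulr1; exact: add0r. Qed.

Lemma addunitv_neq x (a : K) j n : n != j -> (x + a *: unitv j) n = x n.
Proof. by move=> /negPf nj; rewrite lpDE lpZE unitvE nj mulr0; exact: addr0. Qed.

Lemma rnorm_disjoint x y : (forall n, x n = 0 \/ y n = 0) ->
  rnorm (x + y) `^ p = rnorm x `^ p + rnorm y `^ p.
Proof.
move=> xy; have H m : power_sum m (x + y) = power_sum m x + power_sum m y.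
  elim: m => [|m IH]; first by rewrite /power_sum !big_ord0 addr0.
  rewrite !power_sumS IH addrACA lpDE; congr (_ + _).
  case: (xy m) => ->; rewrite rnorm0 powR0 ?gt_eqF//.
    by rewrite [RHS]add0r; congr (rnorm _ `^ _); exact: add0r.
  by rewrite [RHS]addr0; congr (rnorm _ `^ _); exact: addr0.
apply/eqP; rewrite eq_le; apply/andP; split.
  by apply: rnorm_pow_le => m; rewrite H lerD ?power_sum_le.
rewrite -lerBrDr; apply: rnorm_pow_le => m.
rewrite lerBrDl -lerBrDr; apply: rnorm_pow_le => n.
rewrite lerBrDr; apply: le_trans (power_sum_le (maxn m n) _).
by rewrite H addrC lerD// power_sum_homo ?leq_maxl ?leq_maxr.
Qed.

Lemma rnorm_le_coord x y : (forall n, abs (x n) <= abs (y n)) -> rnorm x <= rnorm y.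
Proof.
move=> xy; rewrite rnorm_le_pow; apply: rnorm_pow_le => m.
apply: le_trans (power_sum_le m y); apply: ler_sum => n _.
by rewrite ge0_ler_powR ?nnegrE ?rnorm_ge0 ?(ltW p0).
Qed.

Lemma rnorm_unitv j : rnorm (unitv j) = 1.
Proof.
apply/eqP; rewrite eq_le; apply/andP; split; last first.
  apply: le_trans (coord_le (unitv j) j).
  by rewrite unitvE eqxx -[X in rnorm X](Kreal1 R k) rnorm_Kreal.
rewrite rnorm_le1_pow; apply: rnorm_pow_le => m; exact: power_sum_unitv.
Qed.

Lemma rnorm_addunitv x (a : K) j : x j = 0 ->
  rnorm (x + a *: unitv j) `^ p = rnorm x `^ p + abs a `^ p.
Proof.
move=> xj; rewrite rnorm_disjoint => [|n].
  by rewrite rnormZ rnorm_unitv mulr1.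
have [->|nj] := eqVneq n j; [by left|right].
by rewrite lpZE unitvE (negPf nj) mulr0.
Qed.

(** Write x = y + x_j e_j with y_j = 0, and apply [rnorm_addunitv] to y for
    both x and x + a e_j. *)
Lemma rnorm_change_coord x (a : K) j :
  rnorm (x + a *: unitv j) `^ p =
  rnorm x `^ p - abs (x j) `^ p + abs (x j + a) `^ p.
Proof.
have y0 : (x - x j *: unitv j) j = 0.
  by rewrite lpBE lpZE unitvE eqxx mulr1; exact: subrr.
have H b := @rnorm_addunitv _ b j y0.
have -> : rnorm x `^ p = rnorm (x - x j *: unitv j) `^ p + abs (x j) `^ p.
  by rewrite -H subrK.
by rewrite addrK -H scalerDl addrA subrK.
Qed.

Definition trunc m x : X := \sum_(i < m) x i *: unitv i.

Lemma truncS m x : trunc m.+1 x = trunc m x + x m *: unitv m.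
Proof. by rewrite /trunc big_ord_recr. Qed.

Lemma trunc_coord m x n : trunc m x n = if (n < m)%N then x n else 0.
Proof.
elim: m n => [|m IH] n; first by rewrite /trunc big_ord0.
rewrite truncS ltnS leq_eqVlt.
have [->|nm] := eqVneq n m; last by rewrite orFb addunitv_neq.
rewrite orTb.
by rewrite addunitv_eq// IH ltnn.
Qed.

Lemma sub_trunc_coord m x n : (x - trunc m x) n = if (n < m)%N then 0 else x n.
Proof.
rewrite lpBE trunc_coord; case: ifP => _; [exact: subrr|exact: subr0].
Qed.

Lemma rnorm_trunc m x : rnorm (trunc m x) <= rnorm x.
Proof.
apply: rnorm_le_coord => n; rewrite trunc_coord.
by case: ifP => // _; rewrite rnorm0 rnorm_ge0.
Qed.

Lemma rnorm_sub_trunc m x : rnorm (x - trunc m x) <= rnorm x.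
Proof.
apply: rnorm_le_coord => n; rewrite sub_trunc_coord.
by case: ifP => // _; rewrite rnorm0 rnorm_ge0.
Qed.

Lemma rnorm_trunc_split m x :
  rnorm x `^ p = rnorm (trunc m x) `^ p + rnorm (x - trunc m x) `^ p.
Proof.
rewrite -rnorm_disjoint => [|n]; first by rewrite subrKC.
rewrite trunc_coord sub_trunc_coord; case: ifP => _; [by right|by left].
Qed.

Lemma power_sum_trunc m x : power_sum m x <= rnorm (trunc m x) `^ p.
Proof.
apply: le_trans (power_sum_le m _); apply: ler_sum => n _.
by rewrite trunc_coord ltn_ord.
Qed.

Lemma sub_trunc_small x e : 0 < e -> exists m, forall n, (m <= n)%N ->
  rnorm (x - trunc n x) <= e.
Proof.
move=> e0; have [m xm] := @power_sum_gt x (e `^ p) (powR_gt0 _ e0).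
exists m => n mn; rewrite -(powR_le_iff p0) ?rnorm_ge0 ?(ltW e0)//.
have := rnorm_trunc_split n x; have := power_sum_trunc n x.
have := power_sum_homo x mn; lra.
Qed.

Lemma coord_small x e : 0 < e -> exists m, forall n, (m <= n)%N -> abs (x n) <= e.
Proof.
move=> /(sub_trunc_small x)[m xm]; exists m => n mn.
apply: le_trans (xm _ mn); apply: le_trans (coord_le _ n).
by rewrite sub_trunc_coord ltnn.
Qed.

(** Functionals of l_p are approximated in norm by their finite sections.
    Otherwise there are disjointly supported vectors u_i in the ball with
    f u_i = e; the sum of N of them has norm at most N^(1/p), so that
    N e <= |f| N^(1/p) for all N, which fails because p > 1. *)
Lemma dual_trunc_small (f : dual_space X) e : 0 < e -> exists m, forall x,
  rnorm x <= 1 -> abs (f (x - trunc m x)) <= e.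
Proof.
move=> e0; apply: contrapT => /forallNP H.
have step m : exists n, exists u : X, [/\ (m <= n)%N,
    forall i, (i < m)%N || (n <= i)%N -> u i = 0, rnorm u <= 1 & f u = Kreal k e].
  have /existsNP[x /not_implyP[x1 /negP]] := H m.
  rewrite -ltNge => fx.
  pose w := x - trunc m x; have w1 : rnorm w <= 1.
    exact: le_trans (rnorm_sub_trunc _ _) x1.
  (* g is the room left for truncating w to a finitely supported vector *)
  pose g := abs (f w) - e; have g0 : 0 < g by rewrite subr_gt0.
  have of0 : 0 < opnorm f + 1 := ltr_wpDl (opnorm_ge0 f) ltr01.
  have [n0 wn] := @sub_trunc_small w (g / (opnorm f + 1))
    (divr_gt0 g0 of0).
  pose n := maxn m n0; pose v := trunc n w.
  have fv : e < abs (f v).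
    have : abs (f w) <= abs (f v) + abs (f (w - v)).
      by have := ler_rnormD (f v) (f (w - v)); rewrite -linearD subrKC.
    have : abs (f (w - v)) < g.
      apply: le_lt_trans (rnorm_le_opnorm f _) _.
      have := wn _ (leq_maxr m n0); rewrite -/v (ler_pdivlMr _ _ of0) => Hw.
      have [->|nw] := eqVneq (rnorm (w - v)) 0; first by rewrite mulr0.
      have : 0 < rnorm (w - v) by rewrite lt_def nw rnorm_ge0.
      have := opnorm_ge0 f; nra.
    by rewrite /g; lra.
  have fv0 : f v != 0 by apply: contraTN fv => /eqP ->; rewrite rnorm0 -leNgt ltW.
  exists n, ((Kreal k e / f v) *: v); split.
  - exact: leq_maxl.
  - move=> i; rewrite lpZE /v trunc_coord sub_trunc_coord.
    case/orP => [-> | ]; first by case: ifP => _; rewrite mulr0.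
    by rewrite leqNgt => /negPf ->; rewrite mulr0.
  - rewrite rnormZ; have v1 : rnorm v <= 1 by exact: le_trans (rnorm_trunc _ _) w1.
    have av : abs (Kreal k e / f v) <= 1.
      have E : abs (Kreal k e / f v) * abs (f v) = e.
        by rewrite -(@rnormZ _ _ K^o) /GRing.scale/= divfK// rnorm_Kreal// ltW.
      have := @rnorm_ge0 _ _ K^o (Kreal k e / f v : K); nra.
    by rewrite mulr_ile1 ?rnorm_ge0.
  - by rewrite linearZ/= /GRing.scale/= divfK.
have sums N : exists m, exists v : X, [/\ forall i, (m <= i)%N -> v i = 0,
    rnorm v `^ p <= N%:R & f v = Kreal k (N%:R * e)].
  elim: N => [|N [m [v [vm vN fv]]]].
    exists 0%N, 0; split=> //; first by rewrite rnorm0 powR0 ?gt_eqF.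
    by rewrite mul0r Kreal0 linear0.
  have [n [u [mn u0 u1 fu]]] := step m.
  exists n, (v + u); split => [i ni||].
  - by rewrite lpDE vm ?(leq_trans mn)// u0 ?ni ?orbT//; exact: addr0.
  - rewrite rnorm_disjoint => [|i]; last first.
      by have [mi|im] := leqP m i; [left; exact: vm|right; rewrite u0// im].
    by rewrite -natr1 lerD// -rnorm_le1_pow.
  - by rewrite linearD/= fv fu -KrealD -natr1 mulrDl mul1r.
have pm1 : 0 < p - 1 by rewrite subr_gt0.
have [N NC] := powR_unbounded ((opnorm f / e) `^ p) pm1.
have N0 : 0 < N%:R :> R.
  rewrite lt_neqAle ler0n andbT; apply: contraTN NC => /eqP <-.
  by rewrite powR0 ?gt_eqF// -leNgt powR_ge0.
have [m [v [_ vN fv]]] := sums N.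
have := rnorm_le_opnorm f v; rewrite fv rnorm_Kreal ?mulr_ge0 ?(ltW e0)//.
rewrite -(powR_le_iff p0) ?mulr_ge0 ?rnorm_ge0 ?opnorm_ge0 ?(ltW e0)//.
rewrite leNgt => /negP; apply.
rewrite powRM ?rnorm_ge0 ?opnorm_ge0//.
apply: (@le_lt_trans _ _ (opnorm f `^ p * N%:R)); first by rewrite ler_wpM2l ?powR_ge0.
rewrite -[opnorm f](@divfK _ e) ?gt_eqF// [in ltLHS]powRM ?divr_ge0 ?opnorm_ge0 ?(ltW e0)//.
rewrite [in ltRHS]powRM ?(ltW e0) ?ler0n// -(mulr_powRB1 (ler0n _ N) p0).
by rewrite mulrAC ltr_pM2r ?powR_gt0// mulrC ltr_pM2l.
Qed.

Lemma dual_unitv_small (f : dual_space X) e : 0 < e -> exists m, forall n,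
  (m <= n)%N -> abs (f (unitv n)) <= e.
Proof.
move=> /(dual_trunc_small f)[m fm]; exists m => n mn.
have -> : unitv n = unitv n - trunc m (unitv n).
  apply: lp_ext => i; rewrite sub_trunc_coord unitvE.
  by case: ifP => // im; rewrite ltn_eqF// (leq_trans im).
by apply: fm; rewrite rnorm_unitv.
Qed.

End lp_coordinates.

(** * Forcing norming vectors by an extremal coefficient *)

Section extremal_perturbation.
Variables (R : realType) (k : scalar_kind) (X : normedModType (scalar_field R k)).
Variables (A B E : bop X X) (eta beta rho c : R) (phi : bop X X -> X -> R).
Let T (d : R) : bop X X := A + Kreal k beta *: B + Kreal k d *: E.

Hypothesis eta_gt0 : 0 < eta.
Hypothesis beta_gt0 : 0 < beta.
Hypothesis rho_gt0 : 0 < rho.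
Hypothesis c_gt0 : 0 < c.
Hypothesis A_le : opnorm A <= 1 - eta.
Hypothesis AE_le : opnorm (A + E) <= 1.
Hypothesis B_le : opnorm B <= 1.
Hypothesis T0_le : opnorm (T 0) <= 1.
Hypothesis T_bound : forall d : R, 0 <= d -> opnorm (T d) <= 1 -> d <= 1 - rho.
Hypothesis phi_small : forall S x (t : R), 0 < t -> t <= c -> opnorm S <= 1 ->
  rnorm x <= 1 -> phi S x < c ->
  rnorm (S x + Kreal k t *: B x) <= 1 + eta * rho / (2 * beta) * t.

(** The three operators correspond to the entries (beta + t, d), (0, 1) and
    (0, 0); the weights are such that the first entry of the combination is
    again beta. *)
Let T_convex w1 w2 w3 d t x : w1 + w2 + w3 = 1 -> w1 * (beta + t) = beta ->
  T (w1 * d + w2) x = Kreal k w1 *: (T d x + Kreal k t *: B x) +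
    Kreal k w2 *: (A + E) x + Kreal k w3 *: A x.
Proof.
move=> w123 wb; rewrite /T !bopDE !bopZE !scalerDr !scalerA -!KrealM.
rewrite -[A x in LHS]scale1r -(Kreal1 R k) -w123 -[in LHS]wb mulrDr.
rewrite !KrealD !scalerDl.
by rewrite [LHS](AC (3*2*2) (1*4*6*5*(2*7)*3)).
Qed.

(** If phi is small at all almost normed vectors, T d + t B is a contraction
    up to a factor 1 + o(t), since t <= delta makes the other vectors harmless.
    The excess is absorbed by the weight w3 given to A, whose norm is at most
    1 - eta, and w2 increases d by an amount that does not depend on d. *)
Let raise_entry delta d : 0 < delta -> 0 <= d -> opnorm (T d) <= 1 ->
  (forall x, rnorm x <= 1 -> 1 - delta <= rnorm (T d x) -> phi (T d) x < c) ->
  let t := Num.min c delta in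
  exists2 d', d + beta / (beta + t) * t * rho / (2 * beta) <= d' &
    opnorm (T d') <= 1.
Proof.
move=> delta0 d0 Td bad t.
have t0 : 0 < t by rewrite lt_min c_gt0.
have tc : t <= c by rewrite ge_min lexx.
have td : t <= delta by rewrite ge_min lexx orbT.
have d1 := T_bound d0 Td.
have bt0 : 0 < beta + t by rewrite addr_gt0.
pose kap := eta * rho / (2 * beta).
have kap0 : 0 < kap by do ?[apply: divr_gt0|apply: mulr_gt0|apply: addr_gt0].
have Tt x : rnorm x <= 1 -> rnorm (T d x + Kreal k t *: B x) <= 1 + kap * t.
  move=> x1; have [Tx|Tx] := leP (1 - delta) (rnorm (T d x)).
    by apply: phi_small => //; exact: bad.
  rewrite (le_trans (ler_rnormD _ _))// rnormZ_Kreal ?(ltW t0)//.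
  have : rnorm (B x) <= 1 by apply: le_trans (opnorm_ub B x1) B_le.
  have : 0 <= kap * t by rewrite mulr_ge0 ?ltW.
  have := rnorm_ge0 (B x); nra.
(* w1 restores the entry beta, w3 compensates the excess kap t of the norm *)
pose w1 := beta / (beta + t); pose w3 := w1 * t * rho / (2 * beta).
pose w2 := 1 - w1 - w3.
have w10 : 0 < w1 by rewrite divr_gt0.
have w1t : 1 - w1 = w1 * t / beta by rewrite /w1; field; rewrite !gt_eqF.
have w30 : 0 < w3 by do ?[apply: divr_gt0|apply: mulr_gt0|apply: addr_gt0].
have u0 : 0 < w1 * t / beta by do ?[apply: divr_gt0|apply: mulr_gt0|apply: addr_gt0].
have w3u : w3 = w1 * t / beta * (rho / 2) by rewrite /w3; field; rewrite gt_eqF.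
have w20 : 0 <= w2 by rewrite /w2 w1t w3u; nra.
exists (w1 * d + w2); first by rewrite -/w3 /w2 w3u; nra.
apply: opnorm_le => x x1.
rewrite (@T_convex w1 w2 w3 d t x); [|by rewrite /w2; ring|by rewrite /w1 divfK ?gt_eqF].
apply: le_trans (ler_rnormD _ _) _.
apply: le_trans (lerD (ler_rnormD _ _) (lexx _)) _.
rewrite !rnormZ_Kreal ?(ltW w10) ?(ltW w30)//.
have H1 := Tt x x1.
have H2 : rnorm ((A + E) x) <= 1 by apply: le_trans (opnorm_ub _ x1) AE_le.
have H3 : rnorm (A x) <= 1 - eta by apply: le_trans (opnorm_ub _ x1) A_le.
have H4 : w1 * kap * t = w3 * eta by rewrite /w3 /kap; field; rewrite gt_eqF.
have := ler_wpM2l (ltW w10) H1; have := ler_wpM2l w20 H2.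
have := ler_wpM2l (ltW w30) H3; rewrite /w2 in w20 *; lra.
Qed.

(** The function phi measures the coordinate that has to be nonzero at a
    norming vector; c is uniform in delta, while d and x depend on delta.
    Without such x, [raise_entry] would produce contractions T d with d beyond
    any bound. *)
Lemma extremal_perturbation delta : 0 < delta -> exists d,
  [/\ 0 <= d, d <= 1, opnorm (T d) <= 1 &
    exists x, [/\ rnorm x <= 1, 1 - delta <= rnorm (T d x) & c <= phi (T d) x]].
Proof.
move=> delta0; apply: contrapT => /forallNP H.
have t0 : 0 < Num.min c delta by rewrite lt_min c_gt0.
set t := Num.min c delta in t0.
pose g := beta / (beta + t) * t * rho / (2 * beta).
have g0 : 0 < g.
  by rewrite /g; do ?[apply: divr_gt0|apply: mulr_gt0|apply: addr_gt0].
have /(_ (Num.truncn g^-1).+1) [d gd Td] :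
    forall n : nat, exists2 d, n%:R * g <= d & opnorm (T d) <= 1.
  elim=> [|n [d nd Td]]; first by exists 0; rewrite ?mul0r.
  have d0 : 0 <= d by apply: le_trans nd; rewrite mulr_ge0 ?(ltW g0).
  have [|d' dd' Td'] := raise_entry delta0 d0 Td.
    move=> x x1 Tx; rewrite ltNge; apply/negP => cx; apply: (H d); split => //.
      by apply: le_trans (T_bound d0 Td) _; rewrite gerBl ltW.
    by exists x.
  by exists d' => //; apply: le_trans dd'; rewrite -natr1 mulrDl mul1r lerD2r.
have d0 : 0 <= d by apply: le_trans gd; rewrite mulr_ge0 ?(ltW g0).
have := T_bound d0 Td; have := truncnS_gt g^-1.
rewrite -(@ltr_pM2r _ g)// mulVf ?gt_eqF//; move: rho_gt0; lra.
Qed.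

End extremal_perturbation.

(** * Perturbing a contraction of l_p far away *)

Section lp_perturbation.
Variables (R : realType) (k : scalar_kind) (p : R) (p1 : 1 < p).
Local Notation K := (scalar_field R k).
Local Notation abs := (fun a : K => rnorm (a : K^o)).
Local Notation X := (lp k (ltW p1)).
Local Notation unitv := (unitv k p1).
Local Notation coordf := (coordf k p1).
Implicit Types (x y : X) (m n i j M : nat) (eta d : R).

Lemma erase_subproof M : (fun x : X => x - x M *: unitv M) \in bop_pred X X.
Proof.
apply: (@bopP _ _ _ _ _ 1) => [a x y|x].
  by rewrite lpDE lpZE scalerDl -scalerA scalerBr opprD addrACA.
rewrite mul1r; apply: rnorm_le_coord => n.
rewrite lpBE lpZE unitvE; have [->|_] := eqVneq n M.
  by rewrite mulr1 [X in rnorm X](_ : _ = 0) ?rnorm0 ?rnorm_ge0//; exact: subrr.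
by rewrite mulr0 [X in rnorm X](_ : _ = x n)//; exact: subr0.
Qed.

Definition erase M : bop X X := Bop (erase_subproof M).

Lemma eraseE M x : erase M x = x - x M *: unitv M. Proof. by []. Qed.

Lemma erase_coord M x : erase M x M = 0.
Proof. by rewrite eraseE lpBE lpZE unitvE eqxx mulr1; exact: subrr. Qed.

Lemma rnorm_erase_pow M x : rnorm (erase M x) `^ p = rnorm x `^ p - abs (x M) `^ p.
Proof.
have E : rnorm x `^ p = rnorm (erase M x) `^ p + abs (x M) `^ p.
  by rewrite -(rnorm_addunitv (x M) (erase_coord M x)) eraseE subrK.
by rewrite E addrK.
Qed.

Lemma rnorm_erase M x : rnorm (erase M x) <= rnorm x.
Proof. by rewrite rnorm_le_pow rnorm_erase_pow gerBl powR_ge0. Qed.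

(** The coordinate M is removed from both the source and the range, which
    leaves room for an independent entry at (M, M). *)
Definition punctured M (T0 : bop X X) : bop X X :=
  Bop (bop_comp_subproof (erase M) (Bop (bop_comp_subproof T0 (erase M)))).

Lemma puncturedE M T0 x : punctured M T0 x = erase M (T0 (erase M x)).
Proof. by []. Qed.

(** The entry sits in column a and row b. *)
Definition matrix_unit a b : bop X X := rank1 (coordf a) (unitv b).

Lemma matrix_unitE a b x : matrix_unit a b x = x a *: unitv b. Proof. by []. Qed.

Lemma rnorm_matrix_unit a b x : rnorm (matrix_unit a b x) = abs (x a).
Proof. by rewrite matrix_unitE rnormZ rnorm_unitv mulr1. Qed.

Lemma opnorm_matrix_unit a b : opnorm (matrix_unit a b) <= 1.
Proof. by apply: opnorm_le1P => x; rewrite rnorm_matrix_unit coord_le. Qed.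

Section perturbed.
Variables (T0 : bop X X) (M : nat) (eta : R).
Hypotheses (T01 : opnorm T0 <= 1) (eta_gt0 : 0 < eta) (eta_le1 : eta <= 1).
Let A := Kreal k (1 - eta) *: punctured M T0.

Lemma rnorm_punctured x : rnorm (punctured M T0 x) <= rnorm (erase M x).
Proof. by rewrite puncturedE (le_trans (rnorm_erase _ _))// le_opnorm1. Qed.

Let eta1 : 0 <= 1 - eta. Proof. by rewrite subr_ge0. Qed.

Let A_coord x : A x M = 0.
Proof. by rewrite bopZE lpZE puncturedE erase_coord mulr0. Qed.

Let rnormA x : rnorm (A x) <= (1 - eta) * rnorm (erase M x).
Proof.
rewrite bopZE (rnormZ_Kreal _ eta1); exact: ler_wpM2l eta1 _ _ (rnorm_punctured x).
Qed.

Let A_le : opnorm A <= 1 - eta.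
Proof.
apply: opnorm_le => x x1; apply: le_trans (rnormA x) _.
by rewrite (ler_piMr eta1)// (le_trans (rnorm_erase _ _)).
Qed.

Let AE_le : opnorm (A + matrix_unit M M) <= 1.
Proof.
apply: opnorm_le1P => x; rewrite bopDE matrix_unitE rnorm_le_pow rnorm_addunitv//.
rewrite -lerBrDr -rnorm_erase_pow -rnorm_le_pow (le_trans (rnormA x))//.
by rewrite ler_piMl ?rnorm_ge0// gerBl ltW.
Qed.

Definition perturbed a b d : bop X X :=
  Kreal k (1 - eta) *: punctured M T0 + Kreal k eta *: matrix_unit a b +
  Kreal k d *: matrix_unit M M.

Lemma perturbedE a b d x : perturbed a b d x =
  A x + Kreal k eta *: (x a *: unitv b) + Kreal k d *: (x M *: unitv M).
Proof. by []. Qed.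

Let perturbed0_le a b : opnorm (perturbed a b 0) <= 1.
Proof.
apply: opnorm_le1P => x; rewrite perturbedE Kreal0 scale0r addr0.
apply: le_trans (ler_rnormD _ _) _.
rewrite -matrix_unitE (rnormZ_Kreal (matrix_unit a b x) (ltW eta_gt0)) rnorm_matrix_unit.
have := rnormA x; have := ler_wpM2l eta1 (rnorm_erase M x).
have := ler_wpM2l (ltW eta_gt0) (coord_le x a); lra.
Qed.

Lemma perturbed_norming a b (c rho : R) (phi : bop X X -> X -> R) :
  0 < rho -> 0 < c ->
  (forall d, 0 <= d -> opnorm (perturbed a b d) <= 1 -> d <= 1 - rho) ->
  (forall S x (t : R), 0 < t -> t <= c -> opnorm S <= 1 -> rnorm x <= 1 ->
    phi S x < c -> rnorm (S x + Kreal k t *: matrix_unit a b x) <= 1 + rho / 2 * t) ->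
  forall delta, 0 < delta -> exists d, [/\ 0 <= d, d <= 1,
    opnorm (perturbed a b d) <= 1 & exists x, [/\ rnorm x <= 1,
      1 - delta <= rnorm (perturbed a b d x) & c <= phi (perturbed a b d) x]].
Proof.
move=> rho0 c0 Hd Hphi delta.
have phi_le S x t : 0 < t -> t <= c -> opnorm S <= 1 -> rnorm x <= 1 ->
    phi S x < c -> rnorm (S x + Kreal k t *: matrix_unit a b x) <= 1 + eta * rho / (2 * eta) * t.
  move=> t0 tc S1 x1 Sc; suff -> : eta * rho / (2 * eta) = rho / 2 by exact: Hphi.
  by field; rewrite gt_eqF.
exact: (extremal_perturbation eta_gt0 eta_gt0 rho0 c0 A_le AE_le (opnorm_matrix_unit a b)
  (perturbed0_le a b) Hd phi_le).
Qed.

End perturbed.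
End lp_perturbation.

(** * Norming vectors of the perturbed contraction *)

Section norming_vectors.
Variables (R : realType) (k : scalar_kind) (p : R) (p1 : 1 < p).
Local Notation K := (scalar_field R k).
Local Notation abs := (fun a : K => rnorm (a : K^o)).
Local Notation X := (lp k (ltW p1)).
Local Notation unitv := (unitv k p1).
Local Notation coordf := (coordf k p1).
Implicit Types (x y : X) (m n i j M : nat) (eta d : R).

Let p0 : 0 < p. Proof. exact: lt_trans ltr01 p1. Qed.

Variables (T0 : bop X X) (M j : nat) (eta : R).
Hypotheses (T01 : opnorm T0 <= 1) (eta_gt0 : 0 < eta) (eta_le1 : eta <= 1).
Hypothesis jM : j != M.
Local Notation T := (perturbed T0 M eta).

Let unitv_diag n : unitv n n = 1. Proof. by rewrite unitvE eqxx. Qed.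
Let unitv_off m n : m != n -> unitv n m = 0.
Proof. by move=> /negPf mn; rewrite unitvE mn. Qed.

Let punctured_coord x : (Kreal k (1 - eta) *: punctured M T0) x M = 0.
Proof. by rewrite bopZE lpZE puncturedE erase_coord mulr0. Qed.

Let erase_unitv : erase k p1 M (unitv M) = 0.
Proof. by rewrite eraseE unitv_diag scale1r subrr. Qed.

(** The extra entry has row M.  The M-th coordinate of the image of e_M + r e_j
    is d + eta r, while the norm of this vector exceeds 1 by at most r^p, which is
    negligible with respect to r since p > 1; this keeps d away from 1. *)
Lemma perturbed_row_norming : exists2 c : R, 0 < c & forall delta, 0 < delta ->
  exists d, [/\ 0 <= d, d <= 1, opnorm (T j M d) <= 1 & exists x,
    [/\ rnorm x <= 1, 1 - delta <= rnorm (T j M d x) & c <= abs (x j)]].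
Proof.
(* with this r one has r^p = eta r / 2, half of the gain eta r *)
pose r := (eta / 2) `^ (p - 1)^-1; pose rho := eta * r / 2.
have e20 : 0 < eta / 2 by rewrite divr_gt0.
have r0 : 0 < r by exact: powR_gt0.
have rho0 : 0 < rho by rewrite divr_gt0// mulr_gt0.
have rp : r `^ p = r * (eta / 2).
  rewrite -(mulr_powRB1 (ltW r0) p0); congr (_ * _).
  by rewrite /r -powRrM mulVf ?powRr1 ?(ltW e20)// subr_eq0 gt_eqF.
exists (rho / 2); first by rewrite divr_gt0.
apply: (perturbed_norming T01 eta_gt0 eta_le1 (phi := fun _ x => abs (x j)) rho0).
- by rewrite divr_gt0.
- move=> d d0 Td; pose v := unitv M + Kreal k r *: unitv j.
  have vM : v M = 1 by rewrite addunitv_neq 1?eq_sym// unitv_diag.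
  have vj : v j = Kreal k r by rewrite addunitv_eq// unitv_off.
  have rp0 : 0 <= r `^ p by exact: powR_ge0.
  have v1 : rnorm v <= 1 + r `^ p.
    rewrite -(powR_le_iff p0) ?rnorm_ge0 ?addr_ge0//.
    rewrite rnorm_addunitv ?unitv_off// rnorm_unitv rnorm_Kreal ?(ltW r0)//.
    by rewrite powR1 ler_powR1D// ltW.
  clearbody v.
  have TvM : (T j M d v) M = Kreal k (eta * r + d).
    rewrite perturbedE !lpDE punctured_coord !lpZE vj vM unitv_diag !mulr1.
    by rewrite KrealD KrealM; congr (_ + _); exact: add0r.
  have edr0 : 0 <= eta * r + d by rewrite addr_ge0// mulr_ge0// ltW.
  have : eta * r + d <= rnorm v.
    have := coord_le (T j M d v) M; rewrite TvM rnorm_Kreal// => /le_trans; apply.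
    exact: le_opnorm1.
  by rewrite /rho; move: v1; rewrite rp; lra.
- move=> S x t t_gt0 tc S1 x1 xj; apply: le_trans (ler_rnormD _ _) _.
  rewrite (rnormZ_Kreal _ (ltW t_gt0)) rnorm_matrix_unit.
  have Sx : rnorm (S x) <= 1 by rewrite (le_trans (le_opnorm1 _ S1)).
  by rewrite lerD// mulrC ler_wpM2r ?ltW.
Qed.

(** The extra entry has column M.  The image of e_M has norm
    (eta^p + d^p)^(1/p), which keeps d away from 1; raising by t an entry that
    acts on a coordinate of size at most c costs O(t c^(p - 1)). *)
Lemma perturbed_column_norming : exists2 c : R, 0 < c & forall delta, 0 < delta ->
  exists d, [/\ 0 <= d, d <= 1, opnorm (T M j d) <= 1 & exists x,
    [/\ rnorm x <= 1, 1 - delta <= rnorm (T M j d x) & c <= abs (T M j d x j)]].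
Proof.
have etap : eta `^ p <= 1.
  have E : (1 : R) `^ p = 1 by rewrite powR1.
  by rewrite -[leRHS]E powR_le_iff ?(ltW eta_gt0).
pose b := (1 - eta `^ p) `^ p^-1; pose rho := 1 - b.
have b0 : 0 <= b by exact: powR_ge0.
have bp : b `^ p = 1 - eta `^ p.
  by rewrite /b -powRrM mulVf ?gt_eqF// powRr1 ?subr_ge0.
have rho0 : 0 < rho.
  rewrite subr_gt0 ltNge -(powR_le_iff p0)// bp powR1 -ltNge gtrBl.
  exact: powR_gt0.
pose n := (Num.truncn p).+1; have pn : p <= n%:R by exact/ltW/truncnS_gt.
have n0 : 0 < n%:R :> R by rewrite ltr0n.
have pm1 : 0 < p - 1 by rewrite subr_gt0.
pose kap := rho / 2; have kap0 : 0 < kap by rewrite divr_gt0.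
pose c := (kap / n%:R) `^ (p - 1)^-1 / 2.
have c0 : 0 < c by rewrite divr_gt0// powR_gt0 ?divr_gt0.
have cE : n%:R * (2 * c) `^ (p - 1) = kap.
  have -> : 2 * c = (kap / n%:R) `^ (p - 1)^-1 by rewrite /c; field.
  have kn0 : 0 <= kap / n%:R by rewrite divr_ge0 ?ltW.
  rewrite -powRrM mulVf ?gt_eqF// powRr1//.
  by rewrite mulrC divfK ?gt_eqF.
exists c => //.
apply: (perturbed_norming T01 eta_gt0 eta_le1 (phi := fun S x => abs (S x j)) rho0) => //.
- move=> d d0 Td; rewrite /rho subKr -(powR_le_iff p0)// bp.
  have TM : T M j d (unitv M) = Kreal k d *: unitv M + Kreal k eta *: unitv j.
    rewrite perturbedE bopZE puncturedE erase_unitv !linear0 ?scaler0 add0r.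
    by rewrite unitv_diag !scale1r addrC.
  have := le_opnorm1 (unitv M) Td; rewrite TM rnorm_le_pow rnorm_addunitv; last first.
    by rewrite lpZE unitv_off// mulr0.
  rewrite rnormZ_Kreal// !rnorm_unitv rnorm_Kreal ?(ltW eta_gt0)// mulr1 powR1; lra.
- move=> S x t t0 tc S1 x1 Sj; rewrite matrix_unitE scalerA.
  have Sx : rnorm (S x) `^ p <= 1 by rewrite -rnorm_le1_pow (le_trans (le_opnorm1 _ S1)).
  have kt0 : 0 <= kap * t by rewrite mulr_ge0 ?ltW.
  rewrite -(powR_le_iff p0) ?rnorm_ge0 ?addr_ge0//.
  apply: (@le_trans _ _ (1 + kap * t)); last by rewrite ler_powR1D// ltW.
  rewrite rnorm_change_coord.
  set u := rnorm (S x j : K^o).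
  have uc : u < c by exact: Sj.
  have u0 : 0 <= u by exact: rnorm_ge0.
  have : rnorm (S x j + Kreal k t * x M : K^o) <= u + t.
    apply: le_trans (@ler_rnormD _ _ K^o _ _) _; rewrite lerD2l.
    rewrite (@rnormZ _ _ K^o) rnorm_Kreal ?(ltW t0)// ler_piMr ?(ltW t0)//.
    exact: le_trans (coord_le _ _) x1.
  rewrite -(powR_le_iff p0) ?rnorm_ge0 ?addr_ge0 ?(ltW t0)//.
  have H1 := powRD_sub p1 u0 t0 pn.
  have H2 : (u + t) `^ (p - 1) <= (2 * c) `^ (p - 1).
    have ut : u + t <= 2 * c by lra.
    have ut0 : 0 <= u + t by rewrite addr_ge0// ltW.
    by rewrite powR_le_iff// (le_trans ut0).
  have H3 : n%:R * t * (u + t) `^ (p - 1) <= kap * t.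
    by rewrite -cE -mulrA (mulrC t) mulrA ler_pM2r// ler_pM2l.
  by move: (Sx) (H1) (H3); set w := rnorm (_ + _ : K^o); lra.
Qed.

Let zmod_shuffle (V : zmodType) (t u v w z : V) :
  t - u - v + w + z - t = w - v + z - u.
Proof. by rewrite [LHS](ACl (1*6*(4*3*5*2)))/= subrr add0r. Qed.

Let perturbed_diff a b d x : T a b d x - T0 x =
  Kreal k eta *: (matrix_unit k p1 a b x - punctured M T0 x) + Kreal k d *: matrix_unit k p1 M M x
  - (x M *: erase k p1 M (T0 (unitv M)) + matrix_unit k p1 M M (T0 x)).
Proof.
have P : punctured M T0 x =
    T0 x - (x M *: erase k p1 M (T0 (unitv M)) + matrix_unit k p1 M M (T0 x)).
  by rewrite puncturedE (eraseE M x) !bop_sub !bop_scale eraseE -matrix_unitE opprD addrA addrAC.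
have E : Kreal k (1 - eta) *: punctured M T0 x =
    punctured M T0 x - Kreal k eta *: punctured M T0 x.
  by apply/eqP; rewrite -subr_eq0 opprB addrA -scalerDl -KrealD subrK Kreal1 scale1r subrr.
rewrite perturbedE bopZE E -!matrix_unitE (scalerBr _ (matrix_unit k p1 a b x)) {1}P.
exact: zmod_shuffle.
Qed.

(** The right-hand side tends to 0 when M goes to infinity and eta to 0,
    uniformly in d; the same holds for [perturbed_dual_dist], because the values
    of a functional at e_M tend to 0. *)
Lemma perturbed_dist a b d x : 0 <= d -> d <= 1 ->
  rnorm (T a b d x - T0 x) <= 2 * eta * rnorm x + 2 * abs (x M) + abs (T0 x M).
Proof.
move=> d0 d1; rewrite perturbed_diff.
have H1 : rnorm (matrix_unit k p1 a b x - punctured M T0 x) <= 2 * rnorm x.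
  apply: le_trans (ler_rnormB _ _) _; rewrite rnorm_matrix_unit mulr_natl mulr2n lerD//.
    exact: coord_le.
  by apply: le_trans (rnorm_punctured M T01 x) (rnorm_erase _ _).
have H2 : rnorm (erase k p1 M (T0 (unitv M))) <= 1.
  by apply: le_trans (rnorm_erase _ _) _; rewrite (le_trans (le_opnorm1 _ T01))// rnorm_unitv.
apply: le_trans (ler_rnormB _ _) _; 
rewrite [leRHS](_ : _ = (2 * eta * rnorm x + abs (x M)) + (abs (x M) + abs (T0 x M))); last by ring.
apply: lerD; last first.
  apply: le_trans (ler_rnormD _ _) _; rewrite rnorm_matrix_unit lerD2r rnormZ.
  by rewrite ler_piMr ?rnorm_ge0.
apply: le_trans (ler_rnormD _ _) _; apply: lerD.
  by rewrite (rnormZ_Kreal _ (ltW eta_gt0)) -mulrA mulrCA ler_pM2l.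
by rewrite (rnormZ_Kreal _ d0) rnorm_matrix_unit ler_piMl ?rnorm_ge0.
Qed.

Lemma perturbed_dual_dist (f : dual_space X) a b d x : 0 <= d -> d <= 1 -> rnorm x <= 1 ->
  abs (f (T a b d x) - f (T0 x)) <=
  2 * eta * opnorm f + 3 * abs (f (unitv M)) + abs (f (T0 (unitv M))).
Proof.
move=> d0 d1 x1; rewrite -bop_sub perturbed_diff.
rewrite bop_sub !bop_add !bop_scale ?matrix_unitE ?bop_scale.
set F := f (unitv M).
have xM y : rnorm y <= 1 -> rnorm (coordf M y *: F) <= rnorm F.
  by move=> y1; rewrite rnormZ ler_piMl ?rnorm_ge0// (le_trans (coord_le _ _)).
have T0x : rnorm (T0 x) <= 1 by rewrite (le_trans (le_opnorm1 _ T01)).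
have T0u : rnorm (T0 (unitv M)) <= 1.
  by rewrite (le_trans (le_opnorm1 _ T01))// rnorm_unitv.
have H1 : rnorm (f (x a *: unitv b - punctured M T0 x)) <= 2 * opnorm f.
  apply: le_trans (rnorm_le_opnorm f _) _; rewrite mulrC ler_wpM2r ?opnorm_ge0//.
  apply: le_trans (ler_rnormB _ _) _; rewrite -matrix_unitE rnorm_matrix_unit mulr2n lerD//.
    exact: le_trans (coord_le _ _) x1.
  apply: le_trans (rnorm_punctured M T01 x) _; exact: le_trans (rnorm_erase _ _) x1.
have H2 : rnorm (f (erase k p1 M (T0 (unitv M)))) <= rnorm (f (T0 (unitv M))) + rnorm F.
  rewrite eraseE bop_sub bop_scale; apply: le_trans (ler_rnormB _ _) _.
  by rewrite lerD2l; exact: xM.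
rewrite [leRHS](_ : _ = (eta * (2 * opnorm f) + rnorm F) +
  (rnorm (f (T0 (unitv M))) + rnorm F + rnorm F)); last by ring.
apply: le_trans (ler_rnormB _ _) _; apply: lerD.
  apply: le_trans (ler_rnormD _ _) _; apply: lerD.
    by rewrite (rnormZ_Kreal _ (ltW eta_gt0)) ler_pM2l.
  rewrite (rnormZ_Kreal _ d0); apply: le_trans (_ : 1 * rnorm F <= _); last by rewrite mul1r.
  by apply: ler_pM => //; [exact: rnorm_ge0|exact: xM].
apply: le_trans (ler_rnormD _ _) _; apply: lerD; last exact: xM.
apply: le_trans H2; rewrite rnormZ ler_piMl ?rnorm_ge0//.
exact: le_trans (coord_le _ _) x1.
Qed.

End norming_vectors.

(** * Rigidity at norming vectors *)

Section rigidity.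
Variables (R : realType) (k : scalar_kind) (p : R) (p1 : 1 < p).
Local Notation K := (scalar_field R k).
Local Notation abs := (fun a : K => rnorm (a : K^o)).
Local Notation X := (lp k (ltW p1)).
Local Notation unitv := (unitv k p1).
Implicit Types (x y u v w : X) (m n i j : nat).

Let p0 : 0 < p. Proof. exact: lt_trans ltr01 p1. Qed.

Let power_sum_avg v u w j e m : 0 <= e ->
  (forall n, 2 * abs (v n) `^ p <= abs (u n) `^ p + abs (w n) `^ p) ->
  2 * (abs (v j) `^ p + e) <= abs (u j) `^ p + abs (w j) `^ p ->
  2 * (power_sum p m v + (if (j < m)%N then e else 0)) <= power_sum p m u + power_sum p m w.
Proof.
move=> e0 H Hj; elim: m => [|m IH]; first by rewrite /power_sum !big_ord0 !addr0 mulr0.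
rewrite !power_sumS ltnS leq_eqVlt; have Hm := H m.
have [jm|jm] := eqVneq j m; last by rewrite orFb; lra.
rewrite orTb; move: IH Hj; rewrite jm ltnn; lra.
Qed.

(** A coordinatewise midpoint inequality sums up to one for norms; the
    summand e records a strict gain at a single coordinate j. *)
Lemma rnorm_pow_midpoint v u w j e : 0 <= e ->
  (forall n, 2 * abs (v n) `^ p <= abs (u n) `^ p + abs (w n) `^ p) ->
  2 * (abs (v j) `^ p + e) <= abs (u j) `^ p + abs (w j) `^ p ->
  2 * (rnorm v `^ p + e) <= rnorm u `^ p + rnorm w `^ p.
Proof.
move=> e0 H Hj; rewrite -ler_pdivlMl// -lerBrDr; apply: rnorm_pow_le => m.
apply: le_trans (power_sum_homo p v (leq_maxl m j.+1)) _.
have := power_sum_avg (maxn m j.+1) e0 H Hj; rewrite leq_maxr.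
have := power_sum_le (maxn m j.+1) u; have := power_sum_le (maxn m j.+1) w; lra.
Qed.

Let row_chain (V A B C D N q t t' : R) : 2 * V <= A + B -> A <= N - q + C ->
  B <= N - q + D -> C + D <= 2 * (q + t) -> N <= 1 -> t <= t' -> V <= 1 + t'.
Proof. by lra. Qed.

Let column_chain (V A B C : R) : 2 * V <= A + B -> A <= C -> B <= C -> V <= C.
Proof. by lra. Qed.

(** Average the contraction inequality over x + z e_j and x - z e_j.  On the
    source side only the coordinate j changes, and p <= 2 bounds the increase by
    a multiple of z^2.  On the range side convexity keeps S x on the coordinates
    below m and z S e_j on the others. *)
Lemma row_rigidity (S : bop X X) x j m (c z : R) : p <= 2 -> opnorm S <= 1 ->
  rnorm x <= 1 -> 0 < c -> c <= abs (x j) -> 0 < z ->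
  rnorm (trunc m (S x)) `^ p + z `^ p * rnorm (S (unitv j) - trunc m (S (unitv j))) `^ p
    <= 1 + c `^ (p - 2) * z ^+ 2.
Proof.
move=> p2 S1 x1 c0 cx z0.
set y := S x; set w := S (unitv j); pose zw := Kreal k z *: w.
pose v := trunc m y + (zw - trunc m zw).
have vE : rnorm v `^ p = rnorm (trunc m y) `^ p + z `^ p * rnorm (w - trunc m w) `^ p.
  rewrite rnorm_disjoint => [|n]; last first.
    by rewrite trunc_coord sub_trunc_coord; case: ifP => _; [right|left].
  congr (_ + _); rewrite -powRM ?(ltW z0) ?rnorm_ge0// -(rnormZ_Kreal _ (ltW z0)).
  congr (rnorm _ `^ _); apply: lp_ext => n.
  rewrite [RHS]lpZE !sub_trunc_coord; case: ifP => _; rewrite ?mulr0// lpZE.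
have H n : 2 * abs (v n) `^ p <= abs ((y + zw) n) `^ p + abs ((y - zw) n) `^ p.
  have -> : v n = if (n < m)%N then y n else zw n.
    by rewrite lpDE trunc_coord sub_trunc_coord; case: ifP => _; [exact: addr0|exact: add0r].
  rewrite lpDE lpBE; case: ifP => _; first exact: powR_scalarDB_ge (ltW p1).
  exact: powR_scalarDB_ger (ltW p1).
have := @rnorm_pow_midpoint v _ _ 0%N 0 (lexx _) H; rewrite !addr0 => /(_ (H 0%N)).
have change a : rnorm (S (x + a *: unitv j)) `^ p <=
    rnorm x `^ p - abs (x j) `^ p + abs (x j + a) `^ p.
  by rewrite -rnorm_change_coord -rnorm_le_pow le_opnorm1.
have Hp : rnorm (y + zw) `^ p <= rnorm x `^ p - abs (x j) `^ p + abs (x j + Kreal k z) `^ p.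
  have -> : y + zw = S (x + Kreal k z *: unitv j) by rewrite bop_add bop_scale.
  exact: change.
have Hm : rnorm (y - zw) `^ p <= rnorm x `^ p - abs (x j) `^ p + abs (x j - Kreal k z) `^ p.
  have -> : y - zw = S (x + (- Kreal k z) *: unitv j) by rewrite scaleNr bop_sub bop_scale.
  exact: change.
have x0 : 0 < abs (x j) by exact: lt_le_trans cx.
have := powR_scalarDB_le2 (Kreal k z) (ltW p1) p2 x0.
rewrite rnorm_Kreal ?(ltW z0)// => Hz.
have cc : abs (x j) `^ (p - 2) * z ^+ 2 <= c `^ (p - 2) * z ^+ 2.
  rewrite ler_pM2r ?exprn_gt0// -[p - 2]opprB !powRN lef_pV2 ?posrE ?powR_gt0//.
  by rewrite ge0_ler_powR ?nnegrE ?subr_ge0 ?(ltW c0) ?(ltW x0).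
move: x1; rewrite rnorm_le1_pow vE => x1 H2.
exact: row_chain H2 Hp Hm Hz x1 cc.
Qed.

(** Average the contraction inequality over x + s u and x - s u, whose p-th
    power norms are at most 1 + s^p because the supports are disjoint.  On the
    range side p >= 2 yields a gain of order s^2 at the coordinate j. *)
Lemma column_rigidity (S : bop X X) x u j m (s : R) : 2 <= p -> opnorm S <= 1 ->
  (forall n, (m <= n)%N -> x n = 0) -> (forall n, (n < m)%N -> u n = 0) ->
  rnorm x <= 1 -> rnorm u <= 1 -> 0 < abs (S x j) -> 0 < s ->
  rnorm (S x) `^ p + abs (S x j) `^ (p - 2) * s ^+ 2 * abs (S u j) ^+ 2 <= 1 + s `^ p.
Proof.
move=> p2 S1 xm um x1 u1 a0 s0.
pose su := Kreal k s *: u; have suE : S su = Kreal k s *: S u by exact: bop_scale.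
have suj : abs (S su j) = s * abs (S u j).
  by rewrite suE lpZE (@rnormZ _ _ K^o) rnorm_Kreal ?(ltW s0).
have H n : 2 * abs (S x n) `^ p <= abs ((S x + S su) n) `^ p + abs ((S x - S su) n) `^ p.
  by rewrite lpDE lpBE; exact: powR_scalarDB_ge (ltW p1).
have e0 : 0 <= abs (S x j) `^ (p - 2) * s ^+ 2 * abs (S u j) ^+ 2.
  apply: mulr_ge0; last exact: sqr_ge0.
  by apply: mulr_ge0; [exact: powR_ge0|exact: sqr_ge0].
have := @rnorm_pow_midpoint (S x) _ _ j _ e0 H.
have := powR_scalarDB_ge2 (S su j) p2 a0; rewrite suj exprMn mulrA => Hj /(_ Hj).
rewrite -bop_add -bop_sub.
have disj y : (forall n, (n < m)%N -> y n = 0) -> rnorm y <= s ->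
    rnorm (S (x + y)) `^ p <= 1 + s `^ p.
  move=> ym ys; apply: (@le_trans _ _ (rnorm (x + y) `^ p)).
    by rewrite -rnorm_le_pow le_opnorm1.
  rewrite rnorm_disjoint => [|n];
    last by have [?|?] := leqP m n; [left; exact: xm|right; exact: ym].
  by rewrite lerD -?rnorm_le1_pow// powR_le_iff ?rnorm_ge0// ltW.
have sus : rnorm su <= s by rewrite (rnormZ_Kreal _ (ltW s0)) ler_piMr// ltW.
have su0 n : (n < m)%N -> su n = 0 by move=> nm; rewrite lpZE um// mulr0.
have nsu0 n : (n < m)%N -> (- su) n = 0.
  by move=> nm; rewrite -scaleN1r lpZE su0// mulr0.
have nsus : rnorm (- su) <= s by rewrite rnormN.
move=> H2; exact: column_chain H2 (disj _ su0 sus) (disj _ nsu0 nsus).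
Qed.

End rigidity.

(** * Comparing dense sets of two topologies *)

Section similarity.
Variables (T : choiceType) (A : set T).

(** The second hypothesis says that the interior for tau1 of a neighbourhood
    for tau2 is never empty, relatively to A. *)
Lemma similar_induced (tau1 tau2 : Topological T) :
  (forall x : T, nbhs (x : Topological.Pack tau1) `<=` nbhs (x : Topological.Pack tau2)) ->
  (forall (x : T) V, A x -> nbhs (x : Topological.Pack tau2) V ->
     exists y W, [/\ A y, nbhs (y : Topological.Pack tau1) W & W `&` A `<=` V]) ->
  similar_topologies (induced_topology tau1 A) (induced_topology tau2 A).
Proof.
move=> tau12 tau21 D; split=> dD O [x Ox] [C oC CO].
  have Ax : A (set_val x) by exact: set_valP.
  have Cx : C (set_val x) by move: Ox; rewrite -CO.
  have [y [W [Ay Wy WV]]] := tau21 _ _ Ax (open_nbhs_nbhs (conj oC Cx)).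
  have [z [Wz Dz]] : ((set_val : A -> T) @^-1` (@interior (Topological.Pack tau1) W)) `&` D !=set0.
    apply: dD; last by exists (@interior (Topological.Pack tau1) W) => //; exact: open_interior.
    by exists (SigSub (mem_set Ay)).
  exists z; split=> //; rewrite -CO; apply: WV; split; last exact: set_valP.
  exact: (@interior_subset (Topological.Pack tau1) W).
apply: dD; first by exists x.
exists C => //.
rewrite (@openE (Topological.Pack tau2)) => t Ct; apply: tau12.
exact: open_nbhs_nbhs.
Qed.

Section refinement.
Variables (R : realType) (Delta : nat -> T -> T -> R) (tauw taus tau1 tau2 : Topological T).

Hypothesis Delta_triangle : forall j (z y w : T), Delta j z y <= Delta j z w + Delta j w y.
Hypothesis Delta_sym : forall j (z y : T), Delta j z y = Delta j y z.
Hypothesis tauw_le : forall x : T,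
  nbhs (x : Topological.Pack tauw) `<=` nbhs (x : Topological.Pack tau1).
Hypothesis tau1_le2 : forall x : T,
  nbhs (x : Topological.Pack tau1) `<=` nbhs (x : Topological.Pack tau2).
Hypothesis tau1_les : forall x : T,
  nbhs (x : Topological.Pack tau1) `<=` nbhs (x : Topological.Pack taus).
Hypothesis Delta_continuous : forall j (x : T) (e : R), 0 < e ->
  nbhs (x : Topological.Pack taus) [set z | Delta j z x < e].
Hypothesis tau2_generated : forall (x : T) V, A x ->
  nbhs (x : Topological.Pack tau2) V -> exists n (e : R) W,
  [/\ 0 < e, nbhs (x : Topological.Pack tau1) W & forall z, A z -> W z ->
    (forall j, (j < n)%N -> Delta j z x < e) -> V z].
(** From any point one can move, within a given neighbourhood for taus, to a
    point near which Delta j is already controlled by the coarse topology tauw. *)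
Hypothesis Delta_tame : forall j (e : R) (x : T) U, 0 < e -> A x ->
  nbhs (x : Topological.Pack taus) U -> exists y W,
  [/\ A y, U y, nbhs (y : Topological.Pack tauw) W &
    forall z, A z -> W z -> Delta j z y < e].

Let tauw_les (x : T) : nbhs (x : Topological.Pack tauw) `<=` nbhs (x : Topological.Pack taus).
Proof. by move=> V /tauw_le /tau1_les. Qed.

Let nbhs_int (tau : Topological T) (x : T) W : nbhs (x : Topological.Pack tau) W ->
  nbhs (x : Topological.Pack tau) (@interior (Topological.Pack tau) W).
Proof. by move=> Wx; apply: open_nbhs_nbhs; split=> //; exact: open_interior. Qed.

Let nbhs_of_int (tau : Topological T) (x : T) W : @interior (Topological.Pack tau) W x ->
  nbhs (x : Topological.Pack tau) (@interior (Topological.Pack tau) W).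
Proof. exact: nbhs_int. Qed.

(** The coordinates are treated one at a time: the tauw-neighbourhood obtained
    for the first n of them is also one for taus, so the next move can be made
    inside it. *)
Lemma Delta_tame_finite n (e : R) (x : T) U : 0 < e -> A x ->
  nbhs (x : Topological.Pack taus) U -> exists y W,
  [/\ A y, U y, nbhs (y : Topological.Pack tauw) W &
    forall z, A z -> W z -> forall j, (j < n)%N -> Delta j z y < e].
Proof.
move=> e0 Ax; elim: n e e0 x U Ax => [|n IH] e e0 x U Ax Ux.
  exists x, setT; split=> //; last exact: (@filterT _ (nbhs (x : Topological.Pack tauw))).
  exact: (@nbhs_singleton (Topological.Pack taus)).
have e20 : 0 < e / 2 by rewrite divr_gt0.
have [y [W [Ay Uy Wy HW]]] := IH _ e20 x _ Ax (nbhs_int Ux).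
have [y' [W' [Ay' [Uy' Wy'] W'y' HW']]] := @Delta_tame n e y _ e0 Ay
  (@filterI _ _ _ _ _ (nbhs_of_int Uy) (tauw_les (nbhs_int Wy))).
exists y', (W' `&` @interior (Topological.Pack tauw) W); split=> //.
- exact: (@interior_subset (Topological.Pack taus) U).
- exact: filterI W'y' (nbhs_of_int Wy').
move=> z Az [W'z /(@interior_subset (Topological.Pack tauw) W) Wz] j.
rewrite ltnS leq_eqVlt => /predU1P[->|jn]; first exact: HW'.
apply: le_lt_trans (Delta_triangle j z y' y) _.
have := HW z Az Wz j jn.
have := HW y' Ay' (@interior_subset (Topological.Pack tauw) W _ Wy') j jn.
rewrite (Delta_sym j y' y); lra.
Qed.

Lemma similar_of_tame :
  similar_topologies (induced_topology tau1 A) (induced_topology tau2 A).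
Proof.
apply: similar_induced => // x V Ax /(tau2_generated Ax)[n [e [W [e0 Wx WV]]]].
have e20 : 0 < e / 2 by rewrite divr_gt0.
pose U := @interior (Topological.Pack tau1) W `&`
  [set z | forall j, (j < n)%N -> Delta j z x < e / 2].
have Ux : nbhs (x : Topological.Pack taus) U.
  have Ws : nbhs (x : Topological.Pack taus) (@interior (Topological.Pack tau1) W).
    by apply: tau1_les; exact: nbhs_int.
  have Ds m : nbhs (x : Topological.Pack taus)
      [set z | forall j, (j < m)%N -> Delta j z x < e / 2].
    elim: m => [|m IH].
      have -> : [set z : T | forall j, (j < 0)%N -> Delta j z x < e / 2] = setT by apply/seteqP.
      exact: (@filterT _ (nbhs (x : Topological.Pack taus))).
    have FF : Filter (nbhs (x : Topological.Pack taus)) := nbhs_filter _.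
    apply: (@filterS _ _ FF _ _ _ (@filterI _ _ FF _ _ IH (@Delta_continuous m x _ e20))).
    move=> z [H1 H2] j.
    by rewrite ltnS leq_eqVlt => /predU1P[->|]; [exact: H2|exact: H1].
  exact: (@filterI _ (nbhs (x : Topological.Pack taus)) _ _ _ Ws (Ds n)).
have [y [W' [Ay [Wy Hy] W'y HW']]] := Delta_tame_finite n e20 Ax Ux.
exists y, (W' `&` @interior (Topological.Pack tau1) W); split=> //.
  by apply: (@filterI _ _ (nbhs_filter (y : Topological.Pack tau1)) _ _ (tauw_le W'y));
     exact: nbhs_of_int.
move=> z [[W'z Wz] Az]; apply: WV => //.
  exact: (@interior_subset (Topological.Pack tau1) W).
move=> j jn; apply: le_lt_trans (Delta_triangle j z x y) _.
by rewrite [ltRHS]splitr ltrD// ?Hy// HW'.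
Qed.

End refinement.
End similarity.

(** * Convergence in norm *)

Section norm_convergence.
Variables (R : realType) (k : scalar_kind).
Local Notation K := (scalar_field R k).

Lemma ltr_Kreal (a b : R) : (Kreal k a < Kreal k b) = (a < b).
Proof. by rewrite !lt_def ler_Kreal (can_eq (@KrealK R k)). Qed.

Lemma cvg_rnormP (V : normedModType K) (U : Type) (F : set_system U) (FF : Filter F)
    (g : U -> V) (l : V) :
  g @ F --> l <-> forall e : R, 0 < e -> \forall u \near F, rnorm (g u - l) < e.
Proof.
split=> [/cvgrPdist_lt gl e e0|gl].
  have := gl (Kreal k e); rewrite -(Kreal0 R k) ltr_Kreal => /(_ e0).
  by apply: filterS => u; rewrite distrC rnormE ltr_Kreal.
apply/cvgrPdist_lt => e e0; have eK := KreK (ltW e0).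
have : 0 < Kre e by rewrite -ltr_Kreal eK Kreal0.
by move=> /gl; apply: filterS => u; rewrite -ltr_Kreal eK distrC rnormE.
Qed.

End norm_convergence.

(** * Contractions at which weak convergence is strong *)

Section continuity_points.
Variables (R : realType) (k : scalar_kind) (p : R) (p1 : 1 < p).
Local Notation K := (scalar_field R k).
Local Notation abs := (fun a : K => rnorm (a : K^o)).
Local Notation X := (lp k (ltW p1)).
Local Notation unitv := (unitv k p1).
Local Notation coordf := (coordf k p1).
Implicit Types (x y u v w : X) (m n i j : nat) (S T : bop X X).
Local Notation wot T := (nbhs (T : Topological.Pack (WOT X))).

Let p0 : 0 < p. Proof. exact: lt_trans ltr01 p1. Qed.

Lemma wot_near T x (f : dual_space X) (e : R) : 0 < e ->
  wot T [set S : bop X X | abs (f (S x) - f (T x)) < e].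
Proof.
move=> e0; have FF : Filter (wot T) := nbhs_filter _.
have /(@cvg_WOT _ _ _ _ FF) H : wot T --> (T : Topological.Pack (WOT X)) by [].
by have /cvg_rnormP := H x f; exact.
Qed.

Lemma wot_trunc_near T x m (e : R) : 0 < e ->
  wot T [set S : bop X X | rnorm (trunc m (S x) - trunc m (T x)) < e].
Proof.
have FF : Filter (wot T) := nbhs_filter _.
elim: m e => [|m IH] e e0.
  have z y : trunc 0 y = 0 by exact: big_ord0.
  by apply: filterE => S; rewrite /mkset !z subrr rnorm0.
have e20 : 0 < e / 2 by rewrite divr_gt0.
apply: filterS2 (IH _ e20) (wot_near T x (coordf m) e20) => S H1 H2.
rewrite /mkset !truncS opprD addrACA -scalerBl [ltRHS]splitr.
apply: le_lt_trans (ler_rnormD _ _) _; apply: ltrD => //.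
by rewrite rnormZ rnorm_unitv mulr1.
Qed.

Let pn_ex : exists2 n : nat, p <= n%:R & 0 < n%:R :> R.
Proof. by exists (Num.truncn p).+1; [exact/ltW/truncnS_gt|rewrite ltr0n]. Qed.

Lemma near_norming_pow (theta : R) : 0 < theta -> exists2 delta : R, 0 < delta &
  forall r : R, 1 - delta <= r -> 1 - theta <= r `^ p.
Proof.
move=> theta0; have [n pn n0] := pn_ex.
pose delta := Num.min 1 (theta / n%:R).
have delta0 : 0 < delta by rewrite lt_min ltr01 divr_gt0.
have delta1 : delta <= 1 by rewrite ge_min lexx.
have nd : n%:R * delta <= theta.
  by rewrite mulrC -ler_pdivlMr// ge_min lexx orbT.
exists delta => // r dr.
have d10 : 0 <= 1 - delta by rewrite subr_ge0.
apply: (@le_trans _ _ ((1 - delta) `^ p)).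
  have := bernoulli_powR p1 (ltW delta0) delta1 pn; lra.
by rewrite powR_le_iff// (le_trans d10).
Qed.

(** The number z is chosen so that c^(p - 2) z^2, the error in
    [row_rigidity], is half of e^p z^p; then delta is chosen so that the lack of
    norm of S x accounts for the other half. *)
Lemma row_tail j (c e : R) : p < 2 -> 0 < c -> 0 < e -> exists2 delta : R, 0 < delta &
  forall S x m, opnorm S <= 1 -> rnorm x <= 1 -> c <= abs (x j) ->
    1 - delta <= rnorm (trunc m (S x)) ->
    rnorm (S (unitv j) - trunc m (S (unitv j))) <= e.
Proof.
move=> p2 c0 e0; pose q := e `^ p / 2 / c `^ (p - 2).
have cp : 0 < c `^ (p - 2) by exact: powR_gt0.
have ep : 0 < e `^ p by exact: powR_gt0.
have q0 : 0 < q by rewrite !divr_gt0.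
pose z := q `^ (2 - p)^-1; have z0 : 0 < z by exact: powR_gt0.
have zE : c `^ (p - 2) * z ^+ 2 = e `^ p / 2 * z `^ p.
  have -> : z ^+ 2 = z `^ (2 - p) * z `^ p.
    by rewrite -powRD ?(gt_eqF z0) ?implybT// subrK powR_mulrn ?ltW.
  rewrite /z -(powRrM q (2 - p)^-1 (2 - p)) mulVf ?gt_eqF ?subr_gt0// powRr1 ?(ltW q0)//.
  by rewrite /q mulrA (mulrC (c `^ _)) divfK ?gt_eqF.
have zp : 0 < z `^ p by exact: powR_gt0.
have th0 : 0 < e `^ p / 2 * z `^ p by rewrite mulr_gt0// divr_gt0.
have [delta delta0 Hd] := near_norming_pow th0.
exists delta => // S x m S1 x1 cx Sx.
rewrite -(powR_le_iff p0) ?rnorm_ge0 ?(ltW e0)// -(ler_pM2l zp).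
have := row_rigidity m (ltW p2) S1 x1 c0 cx z0; rewrite zE.
have := Hd _ Sx; set A := rnorm (trunc _ _) `^ p; set B := rnorm _ `^ p.
by move: A B => A B; lra.
Qed.

(** The number s is chosen so that 2 s^p = c^(p - 2) s^2 e^2, where one
    s^p is the error in [column_rigidity] and the other one allows for the lack of
    norm of S x. *)
Lemma column_tail j (c e : R) : 2 < p -> 0 < c -> 0 < e -> exists2 delta : R, 0 < delta &
  forall S x u m, opnorm S <= 1 ->
    (forall n, (m <= n)%N -> x n = 0) -> (forall n, (n < m)%N -> u n = 0) ->
    rnorm x <= 1 -> rnorm u <= 1 -> c <= abs (S x j) ->
    1 - delta <= rnorm (S x) -> abs (S u j) <= e.
Proof.
move=> p2 c0 e0; have cp : 0 < c `^ (p - 2) by exact: powR_gt0.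
pose q := c `^ (p - 2) * e ^+ 2 / 2.
have q0 : 0 < q by rewrite divr_gt0// mulr_gt0// exprn_gt0.
pose s := q `^ (p - 2)^-1; have s0 : 0 < s by exact: powR_gt0.
have sE : s `^ p = q * s ^+ 2.
  have -> : s `^ p = s `^ (p - 2) * s `^ 2.
    by rewrite -powRD ?(gt_eqF s0) ?implybT// subrK.
  rewrite /s -(powRrM q (p - 2)^-1 (p - 2)) mulVf ?gt_eqF ?subr_gt0// powRr1 ?(ltW q0)//.
  by rewrite powR_mulrn// powR_ge0.
have sp : 0 < s `^ p by exact: powR_gt0.
have [delta delta0 Hd] := near_norming_pow sp.
exists delta => // S x u m S1 xm um x1 u1 cx Sx.
have Sj0 : 0 < abs (S x j) by exact: lt_le_trans cx.
have := column_rigidity (ltW p2) S1 xm um x1 u1 Sj0 s0.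
have := Hd _ Sx; set A := rnorm (S x) `^ p; set B := rnorm (S u j : K^o).
have B0 : 0 <= B by exact: rnorm_ge0.
have cc : c `^ (p - 2) <= abs (S x j) `^ (p - 2).
  by rewrite ge0_ler_powR ?nnegrE ?subr_ge0 ?(ltW p2) ?(ltW c0) ?(ltW Sj0).
move: cc; set C := rnorm _ `^ (p - 2) => cc HA HB.
suff : B ^+ 2 <= e ^+ 2 by rewrite ler_sqr ?nnegrE// ltW.
have s20 : 0 < s ^+ 2 by rewrite exprn_gt0.
have H1 : c `^ (p - 2) * s ^+ 2 * B ^+ 2 <= C * s ^+ 2 * B ^+ 2.
  by rewrite ler_wpM2r ?sqr_ge0// ler_pM2r.
have H2 : c `^ (p - 2) * s ^+ 2 * B ^+ 2 <= c `^ (p - 2) * s ^+ 2 * e ^+ 2.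
  have -> : c `^ (p - 2) * s ^+ 2 * e ^+ 2 = 2 * s `^ p by rewrite sE /q; field.
  move: HA HB H1; clearbody A B C; lra.
by move: H2; rewrite ler_pM2l// mulr_gt0.
Qed.

Let zmod_split (V : zmodType) (s t a b : V) : s - t = (a - b) + ((s - a) - (t - b)).
Proof. by rewrite opprB [RHS](AC (2*(2*2)) ((3*6)*((1*4)*(5*2))))/= !subrr !addr0. Qed.

(** The tails of S e_j and T e_j are small by [row_tail], and their first
    m coordinates are close because S is close to T for WOT. *)
Lemma vector_continuity j (c e : R) : p < 2 -> 0 < c -> 0 < e -> exists2 delta : R, 0 < delta &
  forall T x, opnorm T <= 1 -> rnorm x <= 1 -> 1 - delta <= rnorm (T x) -> c <= abs (x j) ->
    wot T [set S : bop X X | opnorm S <= 1 -> rnorm (S (unitv j) - T (unitv j)) < e].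
Proof.
move=> p2 c0 e0; have e40 : 0 < e / 4 by rewrite divr_gt0.
have [delta delta0 tail] := row_tail j p2 c0 e40.
have d30 : 0 < delta / 3 by rewrite divr_gt0.
exists (delta / 3) => // T x T1 x1 Tx cx.
have FF : Filter (wot T) := nbhs_filter _.
have [m Hm] := sub_trunc_small (T x) d30; have {}Hm := Hm m (leqnn _).
have tTx : 1 - delta / 3 * 2 <= rnorm (trunc m (T x)).
  have := ler_rnormD (T x - trunc m (T x)) (trunc m (T x)); rewrite subrK.
  move: Hm Tx; lra.
apply: filterS2 (wot_trunc_near T x m d30) (wot_trunc_near T (unitv j) m e40) => S H1 H2 S1.
have tSx : 1 - delta <= rnorm (trunc m (S x)).
  have := ler_rnormB (trunc m (S x)) (trunc m (S x) - trunc m (T x)); rewrite subKr.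
  move: tTx H1; rewrite /mkset; lra.
have tS := tail S x m S1 x1 cx tSx.
have tT : rnorm (T (unitv j) - trunc m (T (unitv j))) <= e / 4.
  by apply: tail T1 x1 cx _; move: tTx; lra.
move: H2 tS tT; rewrite /mkset; set s := S _; set t := T _ => H2 tS tT.
have -> : s - t = (trunc m s - trunc m t) + ((s - trunc m s) - (t - trunc m t)).
  exact: zmod_split.
have := ler_rnormD (trunc m s - trunc m t) ((s - trunc m s) - (t - trunc m t)).
have := ler_rnormB (s - trunc m s) (t - trunc m t).
move: H2 tS tT; lra.
Qed.

(** Uniformity in v holds because the truncated vectors range over the
    bounded subset of a finite-dimensional space. *)
Lemma wot_dual_near T (f : dual_space X) m (e : R) : 0 < e ->
  wot T [set S : bop X X | forall v, rnorm v <= 1 ->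
    abs (f (S (trunc m v)) - f (T (trunc m v))) < e].
Proof.
have FF : Filter (wot T) := nbhs_filter _.
elim: m e => [|m IH] e e0.
  have z y : trunc 0 y = 0 by exact: big_ord0.
  apply: filterE => S v _; have -> : S (trunc 0 v) = T (trunc 0 v) by rewrite z !linear0.
  by rewrite (_ : _ - _ = 0 :> K^o) ?rnorm0//; exact: subrr.
have e20 : 0 < e / 2 by rewrite divr_gt0.
apply: filterS2 (IH _ e20) (wot_near T (unitv m) f e20) => S H1 H2 v v1.
rewrite truncS !bop_add !bop_scale opprD addrACA -scalerBr [ltRHS]splitr.
apply: le_lt_trans (@ler_rnormD _ _ K^o _ _) _; apply: ltrD; first exact: H1.
apply: le_lt_trans H2; rewrite rnormZ ler_piMl ?rnorm_ge0//.
exact: le_trans (coord_le _ _) v1.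
Qed.

(** The vector x is first truncated to a finitely supported x'.  For v in the
    ball, (S v)_j is controlled by [column_tail] on the part of v off the support
    of x', and by WOT on the finite-dimensional rest. *)
Lemma functional_continuity j (c e : R) : 2 < p -> 0 < c -> 0 < e -> exists2 delta : R, 0 < delta &
  forall T x, opnorm T <= 1 -> rnorm x <= 1 -> 1 - delta <= rnorm (T x) -> c <= abs (T x j) ->
    wot T [set S : bop X X | opnorm S <= 1 ->
      rnorm (adjoint S (coordf j) - adjoint T (coordf j)) < e].
Proof.
move=> p2 c0 e0; have e40 : 0 < e / 4 by rewrite divr_gt0.
have c20 : 0 < c / 2 by rewrite divr_gt0.
have c40 : 0 < c / 4 by rewrite divr_gt0.
have [delta0 delta00 tail] := column_tail j p2 c20 e40.
(* the lack of norm grows by delta at each of the truncation of x, the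
   truncation of T x' and the passage from T to S *)
pose delta := Num.min (delta0 / 4) (c / 4).
have d0 : 0 < delta by rewrite lt_min divr_gt0.
have dd : delta <= delta0 / 4 by rewrite ge_min lexx.
have dc : delta <= c / 4 by rewrite ge_min lexx orbT.
exists delta => // T x T1 x1 Tx cx.
have FF : Filter (wot T) := nbhs_filter _.
have [m Hm] := sub_trunc_small x d0; have {}Hm := Hm m (leqnn _).
pose x' := trunc m x; have x'1 : rnorm x' <= 1 by rewrite (le_trans (rnorm_trunc _ _)).
have x'm n : (m <= n)%N -> x' n = 0 by move=> mn; rewrite trunc_coord ltnNge mn.
have Txx' : rnorm (T x - T x') <= delta.
  by rewrite -bop_sub (le_trans (le_opnorm1 _ T1)).
have Tx' : 1 - delta * 2 <= rnorm (T x').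
  have := ler_rnormD (T x - T x') (T x'); rewrite subrK; move: Txx' Tx; lra.
have Tx'j : c * 3 / 4 <= abs (T x' j).
  have := @ler_rnormD _ _ K^o (T x j - T x' j) (T x' j); rewrite subrK.
  have := coord_le (T x - T x') j; rewrite lpBE; move: Txx' cx dc; lra.
have [m2 Hm2] := sub_trunc_small (T x') d0; have {}Hm2 := Hm2 m2 (leqnn _).
apply: filterS3 (wot_trunc_near T x' m2 d0) (wot_near T x' (coordf j) c40)
  (wot_dual_near T (coordf j) m e40) => S H1 H2 H3 S1.
have Sx' : 1 - delta0 <= rnorm (S x').
  apply: le_trans (rnorm_trunc m2 _).
  have := ler_rnormB (trunc m2 (S x')) (trunc m2 (S x') - trunc m2 (T x')); rewrite subKr.
  have := ler_rnormD (T x' - trunc m2 (T x')) (trunc m2 (T x')); rewrite subrK.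
  move: Tx' Hm2 H1 dd; rewrite /mkset; lra.
have Sx'j : c / 2 <= abs (S x' j).
  have := @ler_rnormB _ _ K^o (S x' j) (S x' j - T x' j); rewrite subKr.
  move: H2 Tx'j c0; rewrite /mkset !coordfE; lra.
suff : rnorm (adjoint S (coordf j) - adjoint T (coordf j)) <= e / 4 * 3 by move: e0; lra.
rewrite rnorm_bop; apply: opnorm_le => v v1.
have vm n : (n < m)%N -> (v - trunc m v) n = 0 by move=> nm; rewrite sub_trunc_coord nm.
have v'1 : rnorm (v - trunc m v) <= 1 by rewrite (le_trans (rnorm_sub_trunc _ _)).
have tS := tail S x' _ m S1 x'm vm x'1 v'1 Sx'j Sx'.
have tT : abs (T (v - trunc m v) j) <= e / 4.
  apply: (tail T x' _ m T1 x'm vm x'1 v'1).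
    by move: Tx'j c0; lra.
  by move: Tx' dd d0; lra.
have := H3 v v1.
have -> : (adjoint S (coordf j) - adjoint T (coordf j)) v =
  (coordf j (S (trunc m v)) - coordf j (T (trunc m v))) +
  (S (v - trunc m v) j - T (v - trunc m v) j) :> K^o.
  by rewrite !bop_sub !lpBE !coordfE addrACA subrKC -opprD subrKC.
have := @ler_rnormD _ _ K^o (coordf j (S (trunc m v)) - coordf j (T (trunc m v)))
  (S (v - trunc m v) j - T (v - trunc m v) j).
have := @ler_rnormB _ _ K^o (S (v - trunc m v) j) (T (v - trunc m v) j).
move: tS tT; lra.
Qed.

End continuity_points.

(** * Comparisons between the operator topologies *)

Section topologies.
Variables (R : realType) (k : scalar_kind) (X : normedModType (scalar_field R k)).
Local Notation K := (scalar_field R k).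
Implicit Types (S T : bop X X) (x : X) (f : dual_space X).

Lemma bop_ball1P T : bop_ball1 X T <-> opnorm T <= 1.
Proof. by rewrite /bop_ball1 /mkset rnormE rnorm_bop -(Kreal1 R k) ler_Kreal. Qed.

Let nbhs_cvg (tau : Topological (bop X X)) T :
  nbhs (T : Topological.Pack tau) --> (T : Topological.Pack tau).
Proof. by []. Qed.

Lemma le_wot_sot T :
  nbhs (T : Topological.Pack (WOT X)) `<=` nbhs (T : Topological.Pack (SOT X)).
Proof.
have FF : Filter (nbhs (T : Topological.Pack (SOT X))) := nbhs_filter _.
apply/(@cvg_WOT _ _ _ _ FF) => x f; apply/cvg_rnormP => e e0.
have /(@cvg_SOT _ _ _ _ FF)/(_ x)/cvg_rnormP H := @nbhs_cvg (SOT X) T.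
have f0 : 0 < opnorm f + 1 by rewrite ltr_wpDl ?opnorm_ge0.
apply: filterS (H _ (divr_gt0 e0 f0)) => S; rewrite ltr_pdivlMr// => HS.
rewrite -bop_sub; apply: le_lt_trans (rnorm_le_opnorm f _) (le_lt_trans _ HS).
by rewrite mulrDr mulr1 mulrC lerDl rnorm_ge0.
Qed.

Lemma le_wot_sot_sub_star T :
  nbhs (T : Topological.Pack (WOT X)) `<=` nbhs (T : Topological.Pack (SOT_sub_star X)).
Proof.
have FF : Filter (nbhs (T : Topological.Pack (SOT_sub_star X))) := nbhs_filter _.
apply/(@cvg_WOT _ _ _ _ FF) => x f; apply/cvg_rnormP => e e0.
have /(@cvg_SOT_sub_star _ _ _ _ FF)/(_ f)/cvg_rnormP H := @nbhs_cvg (SOT_sub_star X) T.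
have x0 : 0 < rnorm x + 1 by rewrite ltr_wpDl ?rnorm_ge0.
apply: filterS (H _ (divr_gt0 e0 x0)) => S; rewrite ltr_pdivlMr// => HS.
have := rnorm_le_opnorm (adjoint S f - adjoint T f) x; rewrite -rnorm_bop => HS'.
apply: le_lt_trans HS' (le_lt_trans _ HS).
by rewrite mulrDr mulr1 lerDl rnorm_ge0.
Qed.

Lemma le_sot_sup_star T :
  nbhs (T : Topological.Pack (SOT X)) `<=` nbhs (T : Topological.Pack (SOT_sup_star X)).
Proof.
have FF : Filter (nbhs (T : Topological.Pack (SOT_sup_star X))) := nbhs_filter _.
by have /(@cvg_SOT_sup_star _ _ _ _ FF)[] := @nbhs_cvg (SOT_sup_star X) T.
Qed.

Lemma le_sub_star_sup_star T :
  nbhs (T : Topological.Pack (SOT_sub_star X)) `<=` nbhs (T : Topological.Pack (SOT_sup_star X)).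
Proof.
have FF : Filter (nbhs (T : Topological.Pack (SOT_sup_star X))) := nbhs_filter _.
by have /(@cvg_SOT_sup_star _ _ _ _ FF)[] := @nbhs_cvg (SOT_sup_star X) T.
Qed.

Lemma sot_near T x (e : R) : 0 < e ->
  nbhs (T : Topological.Pack (SOT X)) [set S : bop X X | rnorm (S x - T x) < e].
Proof.
have FF : Filter (nbhs (T : Topological.Pack (SOT X))) := nbhs_filter _.
move=> e0.
by have /(@cvg_SOT _ _ _ _ FF)/(_ x)/cvg_rnormP/(_ e e0) := @nbhs_cvg (SOT X) T.
Qed.

Lemma sot_sub_star_near T f (e : R) : 0 < e ->
  nbhs (T : Topological.Pack (SOT_sub_star X))
    [set S : bop X X | rnorm (adjoint S f - adjoint T f) < e].
Proof.
have FF : Filter (nbhs (T : Topological.Pack (SOT_sub_star X))) := nbhs_filter _.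
move=> e0.
by have /(@cvg_SOT_sub_star _ _ _ _ FF)/(_ f)/cvg_rnormP/(_ e e0) := @nbhs_cvg (SOT_sub_star X) T.
Qed.

Section generated_filter.
Variables (tau : Topological (bop X X)) (Delta : nat -> bop X X -> bop X X -> R) (T : bop X X).

(** The neighbourhoods of T on the ball for the topology generated by tau and
    by the pseudometrics Delta j; a filter allows the convergence criteria of the
    operator topologies to be applied to it. *)
Definition coordinate_filter : set_system (bop X X) := [set V | exists n (e : R) W,
  [/\ 0 < e, nbhs (T : Topological.Pack tau) W & forall z : bop X X, bop_ball1 X z -> W z ->
    (forall j, (j < n)%N -> Delta j z T < e) -> V z]].

Lemma coordinate_filter_filter : Filter coordinate_filter.
Proof.
have FF : Filter (nbhs (T : Topological.Pack tau)) := nbhs_filter _.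
split.
- by exists 0%N, 1, setT; split => //; exact: filterT.
- move=> V V' [n [e [W [e0 TW WV]]]] [n' [e' [W' [e'0 TW' WV']]]].
  exists (maxn n n'), (Num.min e e'), (W `&` W'); split.
  + by rewrite lt_min e0.
  + exact: filterI.
  + move=> z z1 [Wz W'z] H; split.
      apply: WV => // j jn; apply: lt_le_trans (H j _) _; rewrite ?ge_min ?lexx//.
      by rewrite (leq_trans jn)// leq_maxl.
    apply: WV' => // j jn; apply: lt_le_trans (H j _) _; rewrite ?ge_min ?lexx ?orbT//.
    by rewrite (leq_trans jn)// leq_maxr.
- move=> V V' VV' [n [e [W [e0 TW WV]]]]; exists n, e, W; split => // z z1 Wz H.
  exact/VV'/WV.
Qed.

Lemma coordinate_filter_nbhs : nbhs (T : Topological.Pack tau) `<=` coordinate_filter.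
Proof. by move=> W TW; exists 0%N, 1, W. Qed.

Lemma coordinate_filter_ball : coordinate_filter (bop_ball1 X).
Proof.
by exists 0%N, 1, setT; split => //; exact: (@filterT _ (nbhs (T : Topological.Pack tau))).
Qed.

Lemma coordinate_filter_Delta j (e : R) : 0 < e ->
  coordinate_filter [set z | Delta j z T < e].
Proof.
exists j.+1, e, setT; split => //; first exact: (@filterT _ (nbhs (T : Topological.Pack tau))).
by move=> z _ _; exact.
Qed.

End generated_filter.
End topologies.

(** * Generating the topologies on the ball by coordinates *)

Section lp_topologies.
Variables (R : realType) (k : scalar_kind) (p : R) (p1 : 1 < p).
Local Notation K := (scalar_field R k).
Local Notation abs := (fun a : K => rnorm (a : K^o)).
Local Notation X := (lp k (ltW p1)).
Local Notation unitv := (unitv k p1).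
Local Notation coordf := (coordf k p1).
Implicit Types (x y u v w : X) (m n i j : nat) (S T : bop X X).

Definition vector_dist j S T : R := rnorm (S (unitv j) - T (unitv j)).
Definition functional_dist j S T : R :=
  rnorm (adjoint S (coordf j) - adjoint T (coordf j)).

(** On the ball the values at x are uniformly approximated by those at the
    truncations of x. *)
Lemma coordinate_filter_sot (tau : Topological (bop X X)) T : opnorm T <= 1 ->
  coordinate_filter tau vector_dist T --> (T : Topological.Pack (SOT X)).
Proof.
move=> T1; have FF := coordinate_filter_filter tau vector_dist T.
apply/(@cvg_SOT _ _ _ _ FF) => x; apply/cvg_rnormP => e e0.
have trunc_near n (e' : R) : 0 < e' ->
    coordinate_filter tau vector_dist T
      [set S : bop X X | rnorm (S (trunc n x) - T (trunc n x)) < e'].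
  elim: n e' => [|n IH] e' e'0.
    have z : trunc 0 x = 0 by exact: big_ord0.
    apply: filterE => S; have ST : S (trunc 0 x) = T (trunc 0 x) by rewrite z !linear0.
    by rewrite /mkset ST subrr rnorm0.
  have e'20 : 0 < e' / 2 by rewrite divr_gt0.
  have xn0 : 0 < abs (x n) + 1 by rewrite ltr_wpDl ?rnorm_ge0.
  apply: filterS2 (IH _ e'20) (coordinate_filter_Delta tau vector_dist T n (divr_gt0 e'20 xn0)).
  move=> S H1; rewrite /mkset /vector_dist ltr_pdivlMr// => H2.
  rewrite truncS !bop_add !bop_scale opprD addrACA -scalerBr [ltRHS]splitr.
  apply: le_lt_trans (ler_rnormD _ _) _; apply: ltrD => //.
  by apply: le_lt_trans H2; rewrite rnormZ mulrC ler_wpM2l ?rnorm_ge0// lerDl.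
have e40 : 0 < e / 4 by rewrite divr_gt0.
have [n Hn] := sub_trunc_small x e40; have {}Hn := Hn n (leqnn _).
apply: filterS2 (trunc_near n _ e40) (coordinate_filter_ball tau vector_dist T).
move=> S H1 /bop_ball1P S1.
have HS := le_trans (le_opnorm1 (x - trunc n x) S1) Hn.
have HT := le_trans (le_opnorm1 (x - trunc n x) T1) Hn.
have -> : S x - T x = (S (trunc n x) - T (trunc n x)) + (S (x - trunc n x) - T (x - trunc n x)).
  by rewrite !bop_sub addrACA subrKC -opprD subrKC.
apply: le_lt_trans (ler_rnormD _ _) _.
apply: le_lt_trans (lerD (lexx _) (ler_rnormB _ _)) _.
by move: H1 HS HT e0; rewrite /mkset; lra.
Qed.

(** On the ball the functionals S |-> f (S v) are approximated, uniformly in v,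
    by replacing f by its finite sections, by [dual_trunc_small]. *)
Lemma coordinate_filter_sub_star (tau : Topological (bop X X)) T : opnorm T <= 1 ->
  coordinate_filter tau functional_dist T --> (T : Topological.Pack (SOT_sub_star X)).
Proof.
move=> T1; have FF := coordinate_filter_filter tau functional_dist T.
apply/(@cvg_SOT_sub_star _ _ _ _ FF) => f; apply/cvg_rnormP => e e0.
have trunc_near n (e' : R) : 0 < e' ->
    coordinate_filter tau functional_dist T
      [set S : bop X X | forall v, rnorm v <= 1 ->
        abs (f (trunc n (S v)) - f (trunc n (T v))) < e'].
  elim: n e' => [|n IH] e' e'0.
    apply: filterE => S v _; have -> : trunc 0 (S v) = trunc 0 (T v) by rewrite /trunc !big_ord0.
    by rewrite (_ : _ - _ = 0 :> K^o) ?rnorm0//; exact: subrr.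
  have e'20 : 0 < e' / 2 by rewrite divr_gt0.
  have fn0 : 0 < abs (f (unitv n)) + 1 by rewrite ltr_wpDl ?rnorm_ge0.
  apply: filterS2 (IH _ e'20) (coordinate_filter_Delta tau functional_dist T n (divr_gt0 e'20 fn0)).
  move=> S H1; rewrite /mkset /functional_dist ltr_pdivlMr// => H2 v v1.
  rewrite !truncS !bop_add !bop_scale opprD addrACA -scalerBl [ltRHS]splitr.
  apply: le_lt_trans (@ler_rnormD _ _ K^o _ _) _; apply: ltrD; first exact: H1.
  apply: le_lt_trans H2; rewrite rnormZ; apply: ler_pM; rewrite ?rnorm_ge0 ?lerDl//.
  rewrite rnorm_bop; exact: (opnorm_ub (adjoint S (coordf n) - adjoint T (coordf n)) v1).
have e40 : 0 < e / 4 by rewrite divr_gt0.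
have [n Hn] := dual_trunc_small f e40.
apply: filterS2 (trunc_near n _ e40) (coordinate_filter_ball tau functional_dist T).
move=> S H1 /bop_ball1P S1.
suff : rnorm (adjoint S f - adjoint T f) <= e / 4 * 3 by move: e0; lra.
rewrite rnorm_bop; apply: opnorm_le => v v1.
have HS := Hn (S v) (le_trans (le_opnorm1 v S1) v1).
have HT := Hn (T v) (le_trans (le_opnorm1 v T1) v1).
have H := H1 v v1.
have -> : (adjoint S f - adjoint T f) v = (f (trunc n (S v)) - f (trunc n (T v))) +
    (f (S v - trunc n (S v)) - f (T v - trunc n (T v))) :> K^o.
  by rewrite !bop_sub addrACA subrKC -opprD subrKC.
apply: le_trans (@ler_rnormD _ _ K^o _ _) _.
apply: le_trans (lerD (lexx _) (@ler_rnormB _ _ K^o _ _)) _.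
by move: H HS HT; lra.
Qed.

End lp_topologies.

(** * Tameness and similarity *)

Section tameness.
Variables (R : realType) (k : scalar_kind) (p : R) (p1 : 1 < p).
Local Notation K := (scalar_field R k).
Local Notation X := (lp k (ltW p1)).
Implicit Types (x y u v w : X) (m n i j : nat) (S T : bop X X).

Let invn_small (C e : R) : 0 <= C -> 0 < e ->
  exists N : nat, forall n, (N <= n)%N -> n.+2%:R^-1 * C <= e.
Proof.
move=> C0 e0; exists (Num.truncn (C / e)).+1 => n Nn.
rewrite mulrC ler_pdivrMr ?ltr0n// mulrC -ler_pdivrMr//.
apply: le_trans (ltW (truncnS_gt _)) _; rewrite ler_nat.
by rewrite (leq_trans Nn)// leqW.
Qed.

(** The coordinate perturbed is j + 1 + n, which keeps it different from j. *)
Lemma perturbed_cvg T j (a b : nat -> nat) (d : nat -> R) : opnorm T <= 1 ->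
  (forall n, 0 <= d n) -> (forall n, d n <= 1) ->
  (fun n => perturbed T (j.+1 + n) n.+2%:R^-1 (a n) (b n) (d n)) @ \oo -->
    (T : Topological.Pack (SOT_sup_star X)).
Proof.
move=> T1 d0 d1; set Tn := fun n => _.
have eta0 n : 0 < n.+2%:R^-1 :> R by rewrite invr_gt0 ltr0n.
have shift (P : nat -> Prop) : (exists m, forall n, (m <= n)%N -> P n) ->
    exists m, forall n, (m <= n)%N -> P (j.+1 + n)%N.
  by move=> [m Pm]; exists m => n mn; apply: Pm; rewrite (leq_trans mn)// leq_addl.
apply/cvg_SOT_sup_star; split.
  apply/cvg_SOT => x; apply/cvg_rnormP => e e0; have e8 : 0 < e / 8 by rewrite divr_gt0.
  have [N1 H1] := invn_small (rnorm_ge0 x) e8.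
  have [N2 H2] := shift _ (coord_small x e8).
  have [N3 H3] := shift _ (coord_small (T x) e8).
  exists (maxn N1 (maxn N2 N3)) => // n /=; rewrite !geq_max => /and3P[n1 n2 n3].
  have D := @perturbed_dist _ _ _ _ T (j.+1 + n) _ T1 (eta0 n) (a n) (b n) _ x (d0 n) (d1 n).
  apply: le_lt_trans D _; move: (H1 n n1) (H2 n n2) (H3 n n3).
  by rewrite -mulrA; move: (_^-1 * _) => r; lra.
apply/cvg_SOT_sub_star => f; apply/cvg_rnormP => e e0; have e8 : 0 < e / 8 by rewrite divr_gt0.
have [N1 H1] := invn_small (opnorm_ge0 f) e8.
have [N2 H2] := shift _ (dual_unitv_small f e8).
have [N3 H3] := shift _ (dual_unitv_small (adjoint T f) e8).
exists (maxn N1 (maxn N2 N3)) => // n /=; rewrite !geq_max => /and3P[n1 n2 n3].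
suff : rnorm (adjoint (Tn n) f - adjoint T f) <= e / 8 * 6 by move: e0; lra.
rewrite rnorm_bop; apply: opnorm_le => v v1.
have D := @perturbed_dual_dist _ _ _ _ T (j.+1 + n) _ T1 (eta0 n) f
  (a n) (b n) _ v (d0 n) (d1 n) v1.
apply: le_trans D _; move: (H1 n n1) (H2 n n2) (H3 n n3).
by rewrite -mulrA; move: (_^-1 * _) => r; lra.
Qed.

Lemma tame_of_norming (Delta : bop X X -> bop X X -> R) (a b : nat -> nat) j (e : R) :
  (forall T M eta, opnorm T <= 1 -> j != M -> 0 < eta -> eta <= 1 ->
    exists d, let S0 := perturbed T M eta (a M) (b M) d in
    [/\ 0 <= d, d <= 1, opnorm S0 <= 1 & nbhs (S0 : Topological.Pack (WOT X))
      [set S : bop X X | opnorm S <= 1 -> Delta S S0 < e]]) ->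
  forall T (U : set (bop X X)), bop_ball1 X T ->
    nbhs (T : Topological.Pack (SOT_sup_star X)) U ->
    exists (S0 : bop X X) (W : set (bop X X)), [/\ bop_ball1 X S0, U S0,
      nbhs (S0 : Topological.Pack (WOT X)) W &
      forall S : bop X X, bop_ball1 X S -> W S -> Delta S S0 < e].
Proof.
move=> norming T U /bop_ball1P T1 TU.
have /choice[d Hd] n : exists d,
    let S0 := perturbed T (j.+1 + n) n.+2%:R^-1 (a (j.+1 + n)%N) (b (j.+1 + n)%N) d in
    [/\ 0 <= d, d <= 1, opnorm S0 <= 1 & nbhs (S0 : Topological.Pack (WOT X))
      [set S : bop X X | opnorm S <= 1 -> Delta S S0 < e]].
  apply: norming => //; first by rewrite ltn_eqF// leq_addr.
  by rewrite invf_le1 ?ltr0n// ler1n.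
have d0 n : 0 <= d n by case: (Hd n).
have d1 n : d n <= 1 by case: (Hd n).
have [N _ HN] :=
  @perturbed_cvg T j (fun n => a (j.+1 + n)%N) (fun n => b (j.+1 + n)%N) d T1 d0 d1 U TU.
have [_ _ S1 SW] := Hd N.
eexists _, _; split; [exact/bop_ball1P/S1 | exact: HN (leqnn _) | exact: SW |].
by move=> S /bop_ball1P S1' /(_ S1').
Qed.

Lemma vector_dist_tame : p < 2 -> forall j (e : R) T (U : set (bop X X)), 0 < e ->
  bop_ball1 X T -> nbhs (T : Topological.Pack (SOT_sup_star X)) U ->
  exists (S0 : bop X X) (W : set (bop X X)), [/\ bop_ball1 X S0, U S0,
    nbhs (S0 : Topological.Pack (WOT X)) W &
    forall S : bop X X, bop_ball1 X S -> W S -> vector_dist j S S0 < e].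
Proof.
move=> p2 j e T U e0; apply: (@tame_of_norming (@vector_dist R k p p1 j) (fun=> j) id j e) =>
  {}T M eta T1 jM eta0 eta1.
have [c c0 Hc] := perturbed_row_norming T1 eta0 eta1 jM.
have [delta delta0 Hd] := @vector_continuity R k p p1 j _ _ p2 c0 e0.
have [d [d0 d1 Td [x [x1 Tx xj]]]] := Hc _ delta0.
by exists d; split => //; exact: (Hd _ _ Td x1 Tx xj).
Qed.

Lemma functional_dist_tame : 2 < p -> forall j (e : R) T (U : set (bop X X)), 0 < e ->
  bop_ball1 X T -> nbhs (T : Topological.Pack (SOT_sup_star X)) U ->
  exists (S0 : bop X X) (W : set (bop X X)), [/\ bop_ball1 X S0, U S0,
    nbhs (S0 : Topological.Pack (WOT X)) W &
    forall S : bop X X, bop_ball1 X S -> W S -> functional_dist j S S0 < e].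
Proof.
move=> p2 j e T U e0; apply: (@tame_of_norming (@functional_dist R k p p1 j) id (fun=> j) j e) =>
  {}T M eta T1 jM eta0 eta1.
have [c c0 Hc] := perturbed_column_norming T1 eta0 eta1 jM.
have [delta delta0 Hd] := @functional_continuity R k p p1 j _ _ p2 c0 e0.
have [d [d0 d1 Td [x [x1 Tx xj]]]] := Hc _ delta0.
by exists d; split => //; exact: (Hd _ _ Td x1 Tx xj).
Qed.

Lemma similar_vector_dist (tau1 tau2 : Topological (bop X X)) : p < 2 ->
  (forall T, nbhs (T : Topological.Pack (WOT X)) `<=` nbhs (T : Topological.Pack tau1)) ->
  (forall T, nbhs (T : Topological.Pack tau1) `<=` nbhs (T : Topological.Pack tau2)) ->
  (forall T, nbhs (T : Topological.Pack tau1) `<=`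
             nbhs (T : Topological.Pack (SOT_sup_star X))) ->
  (forall T, bop_ball1 X T ->
     coordinate_filter tau1 (@vector_dist R k p p1) T --> (T : Topological.Pack tau2)) ->
  similar_topologies (induced_topology tau1 (bop_ball1 X))
                     (induced_topology tau2 (bop_ball1 X)).
Proof.
move=> p2 w1 w2 w3 gen.
apply: (@similar_of_tame _ _ R (@vector_dist R k p p1) (WOT X) (SOT_sup_star X)) => //.
- move=> j S T S'; rewrite /vector_dist; apply: le_trans (ler_rnormD _ _).
  by rewrite addrA subrK.
- by move=> j S T; rewrite /vector_dist rnorm_distC.
- by move=> j T e e0; apply: le_sot_sup_star; exact: sot_near.
- by move=> T V T1 /(gen _ T1).
- by move=> j e T U e0; exact: vector_dist_tame.
Qed.

Lemma similar_functional_dist (tau1 tau2 : Topological (bop X X)) : 2 < p ->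
  (forall T, nbhs (T : Topological.Pack (WOT X)) `<=` nbhs (T : Topological.Pack tau1)) ->
  (forall T, nbhs (T : Topological.Pack tau1) `<=` nbhs (T : Topological.Pack tau2)) ->
  (forall T, nbhs (T : Topological.Pack tau1) `<=`
             nbhs (T : Topological.Pack (SOT_sup_star X))) ->
  (forall T, bop_ball1 X T ->
     coordinate_filter tau1 (@functional_dist R k p p1) T --> (T : Topological.Pack tau2)) ->
  similar_topologies (induced_topology tau1 (bop_ball1 X))
                     (induced_topology tau2 (bop_ball1 X)).
Proof.
move=> p2 w1 w2 w3 gen.
apply: (@similar_of_tame _ _ R (@functional_dist R k p p1) (WOT X) (SOT_sup_star X)) => //.
- move=> j S T S'; rewrite /functional_dist; apply: le_trans (ler_rnormD _ _).
  by rewrite addrA subrK.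
- by move=> j S T; rewrite /functional_dist rnorm_distC.
- by move=> j T e e0; apply: le_sub_star_sup_star; exact: sot_sub_star_near.
- by move=> T V T1 /(gen _ T1).
- by move=> j e T U e0; exact: functional_dist_tame.
Qed.

End tameness.

Theorem theorem1p2 (R : realType) (k : scalar_kind) (p : R)
    (p1 : 1 < p) (p2 : p != 2) :
  let X : normedModType (scalar_field R k) := lp k (ltW p1) in
  let B1 : set (bop X X) := bop_ball1 X in
  (2 < p ->
    similar_topologies (induced_topology (SOT X) B1) (induced_topology (SOT_sup_star X) B1) /\
    similar_topologies (induced_topology (WOT X) B1) (induced_topology (SOT_sub_star X) B1)) /\
  (p < 2 ->
    similar_topologies (induced_topology (SOT_sub_star X) B1) (induced_topology (SOT_sup_star X) B1) /\
    similar_topologies (induced_topology (WOT X) B1) (induced_topology (SOT X) B1)).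
Proof.
move=> X B1; split=> pp; split.
- apply: similar_functional_dist => //.
  + exact: le_wot_sot.
  + exact: le_sot_sup_star.
  + exact: le_sot_sup_star.
  + move=> T /bop_ball1P T1.
    have FF := coordinate_filter_filter (SOT X) (@functional_dist R k p p1) T.
    apply/(@cvg_SOT_sup_star _ _ _ _ FF); split; last exact: coordinate_filter_sub_star.
    exact: coordinate_filter_nbhs.
- apply: similar_functional_dist => //.
  + by move=> T V.
  + exact: le_wot_sot_sub_star.
  + by move=> T V /le_wot_sot /le_sot_sup_star.
  + by move=> T /bop_ball1P T1; exact: coordinate_filter_sub_star.
- apply: similar_vector_dist => //.
  + exact: le_wot_sot_sub_star.
  + exact: le_sub_star_sup_star.
  + exact: le_sub_star_sup_star.
  + move=> T /bop_ball1P T1.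
    have FF := coordinate_filter_filter (SOT_sub_star X) (@vector_dist R k p p1) T.
    apply/(@cvg_SOT_sup_star _ _ _ _ FF); split; first exact: coordinate_filter_sot.
    exact: coordinate_filter_nbhs.
- apply: similar_vector_dist => //.
  + by move=> T V.
  + exact: le_wot_sot.
  + by move=> T V /le_wot_sot /le_sot_sup_star.
  + by move=> T /bop_ball1P T1; exact: coordinate_filter_sot.
Qed.
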